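(* Let $L$ be an $E$-operator of order $\mu$, and let $E_1(z),\ldots,E_\mu(z)$ be $E$-functions such that, for some upper triangular $\mu\times\mu$ matrix $M$ with rational entries, the components of $(E_1(z),\ldots,E_\mu(z))\cdot z^M$ form a basis of solutions of $L$ at $z=0$. Let $F(z)$ be a local solution of $L$ at $z=0$, written as $$F(z)=\sum_{j=1}^\mu\Big(\sum_{s\in S_j}\sum_{k\in K_j}\phi_{j,s,k}\,z^s\log(z)^k\Big)E_j(z),$$ with finite sets $S_j\subset\mathbb{Q}$, $K_j\subset\mathbb{N}$ and coefficients $\phi_{j,s,k}\in\mathbb{C}$. Let $\alpha\in\overline{\mathbb{Q}}\setminus\{0\}$, let $G_1(z),\ldots,G_\mu(z)\in\overline{\mathbb{Q}}[[z-\alpha]]$ be a basis of local holomorphic solutions of $L$ at $z=\alpha$, and let $\omega_1,\ldots,\omega_\mu\in\mathbb{C}$ be the connexion constants defined by $$F(z)=\omega_1G_1(z)+\cdots+\omega_\mu G_\mu(z)\quad\text{around } z=\alpha.$$ If all the coefficients $\phi_{j,s,k}$ are algebraic, then $\omega_1,\ldots,\omega_\mu$ belong to $\mathbf{E}[\log\alpha]$, and they even belong to $\mathbf{E}$ if $F(z)$ is an $E$-function.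
   Context: $\overline{\mathbb{Q}}$ is the field of algebraic numbers (embedded in $\mathbb{C}$) and $\mathbb{N}=\{0,1,2,\ldots\}$. An $E$-function is a power series $E(z)=\sum_{n\ge0}\frac{a_n}{n!}z^n$ with $a_n\in\overline{\mathbb{Q}}$ for which there is $C>0$ such that: (i) all conjugates of $a_n$ have modulus $\le C^{n+1}$ for all $n$; (ii) there are nonzero integers $d_n$ with $|d_n|\le C^{n+1}$ such that $d_na_m$ is an algebraic integer for all $m\le n$; (iii) $E(z)$ satisfies a homogeneous linear differential equation with coefficients in $\overline{\mathbb{Q}}(z)$. $E$-functions are entire. $\mathbf{E}$ denotes the set of all values taken by any $E$-function at any algebraic point; it is a subring of $\mathbb{C}$ containing $\overline{\mathbb{Q}}$. A $G$-operator is an operator $\mathcal{D}\in\overline{\mathbb{Q}}[z,\frac{d}{dz}]$ satisfying Galochkin's condition: writing $\mathcal{D}y=0$ as a first order system $Y'=AY$ and $Y^{(s)}=A_sY$ for $s\ge1$, and choosing a nonzero polynomial $T(z)$ (with algebraic integer coefficients) such that $TA$ has polynomial entries, if $q_n\ge1$ is the least common denominator of all the coefficients of the entries of $T^sA_s/s!$, $1\le s\le n$, then $\limsup q_n^{1/n}<\infty$. An $E$-operator is an operator of the form $\overline{\mathcal{F}}\mathcal{D}$ with $\mathcal{D}$ a $G$-operator, where $\overline{\mathcal{F}}:\mathbb{C}[z,\frac{d}{dz}]\to\mathbb{C}[x,\frac{d}{dx}]$ is the morphism of $\mathbb{C}$-algebras with $\overline{\mathcal{F}}(z)=\frac{d}{dx}$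 and $\overline{\mathcal{F}}(\frac{d}{dz})=-x$. By André's theorem, the only possible singularities of an $E$-operator are $0$ and $\infty$ (so any $\alpha\in\overline{\mathbb{Q}}\setminus\{0\}$ is a regular point), and $E$-functions $E_1,\ldots,E_\mu$ and a matrix $M$ as in the claim exist, so that every local solution at $0$ has the displayed form. Around $\alpha$ a determination of $\log z$ is fixed; it is used to define $F(z)$ (with $z^s=\exp(s\log z)$) and $\log\alpha$. *)

(* Defs.v *)
From HB Require Import structures.
From mathcomp Require Import all_boot all_order all_algebra.
From mathcomp Require Import finmap complex.
From mathcomp Require Import all_classical all_reals all_analysis.
From mathcomp Require Import ring.

Set Implicit Arguments.
Unset Strict Implicit.
Unset Printing Implicit Defensive.

Import Order.TTheory GRing.Theory Num.Theory.
Import numFieldNormedType.Exports.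

Local Open Scope classical_set_scope.
Local Open Scope ring_scope.

Local Open Scope quotient_scope.
Local Notation "p %:F" := (tofrac p).

Lemma frac_numden (R : idomainType) (x : {fraction R}) :
  x = (frac (repr x)).1%:F / (frac (repr x)).2%:F.
Proof.
set y := repr x.
have d0 : y.2%:F != 0 :> {fraction R} by rewrite tofrac_eq0 denom_ratioP.
apply: (mulIf d0); rewrite mulfVK // -[x]reprK -/y.
unlock tofrac; rewrite -[LHS]FracField.pi_mul; apply/eqmodP.
rewrite /= FracField.equivfE /FracField.mulf !numden_Ratio ?oner_eq0
  ?mulr1 ?mul1r ?denom_ratioP //.
by rewrite mulrC.
Qed.

(* The derivation of K(X), computed on a representative n/d; by [frac_derivE]
   the choice of representative is irrelevant. *)
Definition frac_deriv (K : idomainType) (x : {fraction {poly K}}) :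
    {fraction {poly K}} :=
  let: (n, d) := frac (repr x) in
  (n^`() * d - n * d^`())%:F / (d ^+ 2)%:F.

Lemma frac_derivE (K : idomainType) (p q : {poly K}) : q != 0 ->
  frac_deriv (p%:F / q%:F) = (p^`() * q - p * q^`())%:F / (q ^+ 2)%:F.
Proof.
move=> q0; rewrite /frac_deriv.
have := frac_numden (p%:F / q%:F).
have := @denom_ratioP _ (repr (p%:F / q%:F : {fraction {poly K}})).
move: (frac _) => [n d] /= d0 /eqP.
rewrite eqr_div ?tofrac_eq0 // -!rmorphM tofrac_eq => /eqP nd.
have nd' : p^`() * d + p * d^`() = n^`() * q + n * q^`() by rewrite -!derivM nd.
apply/eqP; rewrite eqr_div ?tofrac_eq0 ?expf_neq0 // -!rmorphM tofrac_eq /=.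
apply/eqP.
have -> : (n^`() * d - n * d^`()) * q ^+ 2 =
          q * ((n^`() * q) * d - (n * q) * d^`()) by ring.
have -> : n^`() * q = p^`() * d + p * d^`() - n * q^`() by rewrite nd' addrK.
rewrite -nd; transitivity (d * (p^`() * d * q - (n * q) * q^`())).
  by ring.
by rewrite -nd; ring.
Qed.

Local Close Scope quotient_scope.

Section ClosedField.
Variable C : numClosedFieldType.

Definition algebraic_number (z : C) : Prop := algebraicOver (ratr : rat -> C) z.

Definition algebraic_integer (z : C) : Prop :=
  integralOver (intr : int -> C) z.

Definition conjugate (z w : C) : Prop :=
  exists2 p : {poly rat}, irreducible_poly p
    & root (map_poly ratr p) z && root (map_poly ratr p) w.

(* An element of C[z, d/dz] in normal form, \sum_j P`_j(z) (d/dz)^j, is encoded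
   as the polynomial P in d/dz with coefficients in C[z]; only the additive
   structure of {poly {poly C}} agrees with that of differential operators. *)
Definition diffop : Type := {poly {poly C}}.

Definition diffop_order (P : diffop) : nat := (size P).-1.

Definition algebraic_diffop (P : diffop) : Prop :=
  forall i j, algebraic_number (P`_j)`_i.

Definition ps_deriv (f : nat -> C) (n : nat) : C := n.+1%:R * f n.+1.

Definition diffop_ps (P : diffop) (f : nat -> C) (n : nat) : C :=
  \sum_(j < size P) \sum_(i < n.+1) (P`_j)`_i * iter j ps_deriv f (n - i)%N.

(* f is the sequence of coefficients a_n/n! of the series. In C the order
   x <= y means that y - x is a nonnegative real, so 0 < c forces c real. *)
Definition E_function (f : nat -> C) : Prop :=
  exists (a : nat -> C) (c : C),
    [/\ (forall n, f n = a n / n`!%:R) /\ (forall n, algebraic_number (a n)),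
        0 < c,
        forall n w, conjugate (a n) w -> `|w| <= c ^+ n.+1,
        exists d : nat -> int,
          [/\ forall n, d n != 0,
              forall n, `|(d n)%:~R| <= c ^+ n.+1 :> C
            & forall n m, (m <= n)%N ->
                algebraic_integer ((d n)%:~R * a m)]
      & exists P : diffop,
          [/\ P != 0, algebraic_diffop P & forall n, diffop_ps P f n = 0]].

Definition ps_sum (f : nat -> C) (z : C) : C :=
  limn (series (fun n => f n * z ^+ n)).

Definition E_value (v : C) : Prop :=
  exists f xi, [/\ E_function f, algebraic_number xi & v = ps_sum f xi].

Definition E_value_adjoin (l v : C) : Prop :=
  exists2 p : {poly C}, (forall i, E_value p`_i) & v = p.[l].

Local Notation ratfun := {fraction {poly C}}.

(* The matrix A of the system Y' = A Y equivalent to D y = 0, where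
   Y = (y, y', ..., y^(m-1)) and m is the order of D. *)
Definition companion_system (D : diffop) : 'M[ratfun]_(diffop_order D) :=
  \matrix_(i, j) if i.+1 == diffop_order D then - (D`_j)%:F / (lead_coef D)%:F
                 else (j == i.+1 :> nat)%:R.

(* Y^(s) = A_s Y, with A_0 = 1 and A_(s+1) = A_s' + A_s A. *)
Fixpoint system_iter m (A : 'M[ratfun]_m) (s : nat) : 'M[ratfun]_m :=
  if s is s'.+1
  then map_mx (@frac_deriv C) (system_iter A s') + system_iter A s' *m A
  else 1%:M.

Definition polynomial_entries m (B : 'M[ratfun]_m) : Prop :=
  forall i j, exists p : {poly C}, B i j = p%:F.

Definition common_denominator (T : {poly C}) m (A : 'M[ratfun]_m)
    (n q : nat) : Prop :=
  (0 < q)%N /\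
  forall s i j, (1 <= s <= n)%N ->
    exists2 p : {poly C}, T%:F ^+ s * system_iter A s i j / s`!%:R = p%:F
      & forall k, algebraic_integer (q%:R * p`_k).

Definition least_common_denominator (T : {poly C}) m (A : 'M[ratfun]_m)
    (n q : nat) : Prop :=
  common_denominator T A n q /\
  forall q', common_denominator T A n q' -> (q <= q')%N.

(* d/dx composed with P: (d/dx) b = b' + b (d/dx). *)
Definition ddx_comp (P : diffop) : diffop := map_poly deriv P + 'X * P.

(* z^i (d/dz)^j is sent to (d/dx)^i (-x)^j, here put in normal form. *)
Definition fourier (D : diffop) : diffop :=
  \sum_(j < size D) \sum_(i < size D`_j)
    ((D`_j)`_i)%:P%:P * iter i ddx_comp ((- 'X) ^+ j)%:P.

Definition cexp (z : C) : C := ps_sum (fun n => (n`!%:R)^-1) z.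

Definition mxexp m (A : 'M[C]_m) : 'M[C]_m :=
  \matrix_(i, j) limn (series (fun k => (A ^+ k) i j / k`!%:R)).

(* Multivalued functions around z = 0 are handled as functions of w = log z,
   i.e. on the universal covering of C \ {0}; a neighbourhood of 0 in the
   z-plane becomes a half-plane Re w < c, and d/dz becomes exp(-w) d/dw. *)
Definition log_nbhs0 : set_system C :=
  [set A | exists2 c : C, c \is Num.real & [set w : C | 'Re w < c] `<=` A].

Definition ddz_log (f : C -> C) (w : C) : C := cexp (- w) * derive1 f w.

Definition solution_at0 (L : diffop) (f : C -> C) : Prop :=
  \forall w \near log_nbhs0, derivable f w 1 /\
    \sum_(j < size L) (L`_j).[cexp w] * iter j ddz_log f w = 0.

Definition holomorphic_solution (L : diffop) (a : C) (f : C -> C) : Prop :=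
  \forall z \near a, derivable f z 1 /\
    \sum_(j < size L) (L`_j).[z] * derive1n j f z = 0.

Definition germ_basis (Fl : set_system C) (V : (C -> C) -> Prop) n
    (b : 'I_n -> C -> C) : Prop :=
  [/\ forall i, V (b i),
      forall c : 'I_n -> C,
        (\forall z \near Fl, \sum_i c i * b i z = 0) -> forall i, c i = 0
    & forall f, V f -> exists c : 'I_n -> C,
        \forall z \near Fl, f z = \sum_i c i * b i z].

(* The j-th component of (E_1(z), ..., E_n(z)) z^M at z = exp w, with
   z^M = exp(M log z). *)
Definition E_times_zM n (E : 'I_n -> nat -> C) (M : 'M[rat]_n)
    (j : 'I_n) (w : C) : C :=
  ((\row_i ps_sum (E i) (cexp w)) *m mxexp (w *: map_mx ratr M)) 0 j.

Definition log_determination (a : C) (l : C -> C) : Prop :=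
  \forall z \near a, {for z, continuous l} /\ cexp (l z) = z.

End ClosedField.

(* Naming [R[i]] as a [numClosedFieldType] gives it the normed topology that
   MathComp-Analysis attaches to every such field, so that [derivable] and
   [derive1] on [CC R -> CC R] are complex differentiability and the complex
   derivative. *)
Definition CC (R : realType) : numClosedFieldType := R[i].

Section Operators.
Variable R : realType.

Definition galochkin (D : diffop (CC R)) : Prop :=
  exists (T : {poly CC R}) (q : nat -> nat),
    [/\ T != 0,
        forall k, algebraic_integer T`_k,
        polynomial_entries (T%:F *: companion_system D),
        forall n, least_common_denominator T (companion_system D) n (q n)
      & (limn_esup (fun n => ((q n)%:R `^ (n%:R^-1) : R)%:E) < +oo)%E].

Definition G_operator (D : diffop (CC R)) : Prop :=
  [/\ D != 0, algebraic_diffop D & galochkin D].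

Definition E_operator (L : diffop (CC R)) : Prop :=
  exists2 D : diffop (CC R), G_operator D & L = fourier D.

End Operators.

(* Main.v *)
Require Import Defs.
From HB Require Import structures.
From mathcomp Require Import all_boot all_order all_algebra.
From mathcomp Require Import finmap complex.
From mathcomp Require Import all_classical all_reals all_analysis.
From mathcomp Require Import ring.

(** Why the theorem is true.

    Write [h z = F (ell z)] near [alpha].  Comparing the Taylor coefficients at
    [alpha] of both sides of [h = \sum_i omega i * G i] gives, for all [n],
    [\sum_i omega i * g i n = h^(n)(alpha) / n!].  The [G i] are linearly
    independent, so the infinite matrix of the algebraic numbers [g i n] has a
    left inverse with algebraic entries supported on finitely many [n]
    ([algebraic_left_inverse]), and every [omega i] is a combination with
    algebraic coefficients of the numbers [h^(n)(alpha)].  A minor of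
    the matrix that is nonzero because of linear independence plays the role of
    the Wronskian at [alpha].  This reduction is [connexion_constants_in].

    It remains to locate the derivatives of [h] at [alpha].  The function [h] is
    a combination of terms [z^s * (log z)^k * f z] with [s] rational, [f] an
    E-function and an algebraic coefficient.  Since [log' = 1 / z], such
    combinations are closed under [d/dz] ([log_combination_deriv]), and at the
    algebraic point [alpha] the factor [alpha^s] is algebraic
    ([algebraic_cexp]); hence all derivatives at [alpha] are polynomials in
    [log alpha] whose coefficients are values at [alpha] of E-functions.  If [h]
    is itself an E-function, its derivatives are E-functions, and no logarithm
    appears.

    What this uses of E-functions is that they form a vector space over the
    algebraic numbers stable under [d/dz] ([E_functionD], [E_functionZ],
    [E_function_deriv]).  All E-functions are evaluated at the one point
    [alpha], so that sums of their values are values of their sums.  For the size conditions, the conjugates of [a - b] and [a / b] are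
    differences and quotients of conjugates, by a resultant argument
    ([conjugate_common_root]).  For the differential equation, a series is
    killed by a nonzero operator exactly when it lies in the span of a
    finite family stable under [d/dz], up to polynomial denominators
    ([D_finite]), and this property is visibly stable under the operations.
    Working over the field of algebraic numbers keeps the operators algebraic.

    On the analytic side, power series over [R[i]] are differentiated inside
    their disc of convergence ([is_derive_ps_sum]), the functional equation of
    the exponential follows from the real one ([cexpD]), and the logarithm is
    differentiated as a continuous right inverse of the exponential
    ([is_derive_right_inverse]). *)

Set Implicit Arguments.
Unset Strict Implicit.
Unset Printing Implicit Defensive.

Import Order.TTheory GRing.Theory Num.Theory.
Import numFieldNormedType.Exports.

Local Open Scope classical_set_scope.
Local Open Scope ring_scope.

(** * Conjugates and denominators of algebraic numbers *)

Section Conjugates.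
Variable C : numClosedFieldType.
Implicit Types z w a b : C.

Local Notation toC := (map_poly (ratr : rat -> C)).

Lemma irreducible_poly_neq0 (p : {poly rat}) : irreducible_poly p -> p != 0.
Proof. by case=> p_size _; rewrite -size_poly_gt0 (leq_trans _ p_size). Qed.

Lemma irreducible_annihilator z : algebraic_number z ->
  exists2 p : {poly rat}, irreducible_poly p & root (toC p) z.
Proof.
case=> p0 p0_neq0 p0z.
(* A rational annihilator of minimal degree is irreducible. *)
pose P n := `[< exists p : {poly rat}, [/\ p != 0, root (toC p) z & size p = n] >].
have exP : exists n, P n by exists (size p0); apply/asboolP; exists p0.
case: (ex_minnP exP) => n /asboolP[p [p_neq0 pz <-]] min_p.
exists p => //; split=> [|d d_size /dvdpP[e def_p]].
  rewrite -(size_map_poly (ratr : {rmorphism rat -> C})).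
  by rewrite (root_size_gt1 _ pz) ?map_poly_eq0.
have min q : q != 0 -> root (toC q) z -> (size p <= size q)%N.
  by move=> q0 qz; apply: min_p; apply/asboolP; exists q.
have /andP[e_neq0 d_neq0] : (e != 0) && (d != 0).
  by move: p_neq0; rewrite def_p mulf_eq0 negb_or.
have d_gt0 : (0 < size d)%N by rewrite size_poly_gt0.
have := size_mul e_neq0 d_neq0; rewrite -def_p => size_p.
move: pz; rewrite {1}def_p rmorphM rootM => /orP[/(min _ e_neq0)|/(min _ d_neq0)].
  rewrite size_p; case: (size d) d_gt0 d_size => // -[|k] // _ _.
  by rewrite !addnS /= -addSn => /(leq_trans (leq_addr k _)); rewrite ltnn.
move=> le_pd; rewrite -dvdp_size_eqp ?def_p ?dvdp_mulIr // -def_p eqn_leq le_pd.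
by rewrite andbT dvdp_leq // def_p dvdp_mulIr.
Qed.

Lemma conjugate_root (q : {poly rat}) z w :
  conjugate z w -> root (toC q) z -> root (toC q) w.
Proof.
move=> [p [p_size p_irr] /andP[pz pw]] qz.
have : (p %| q)%R.
  have := @p_irr (gcdp p q).
  rewrite dvdp_gcdl => /(_ _ isT) gcd_irr.
  apply: dvdp_trans (dvdp_gcdr p q); rewrite -(eqp_dvdl _ (gcd_irr _)) //.
  rewrite gtn_eqF // -(size_map_poly (ratr : {rmorphism rat -> C})).
  rewrite gcdp_map (@root_size_gt1 _ z) ?root_gcd ?pz //.
  by rewrite gcdp_eq0 negb_and map_poly_eq0 irreducible_poly_neq0.
by case/dvdpP=> r ->; rewrite rmorphM rootM pw orbT.
Qed.

Lemma conjugate0 w : conjugate 0 w -> w = 0.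
Proof.
move=> w0; apply/eqP.
have := conjugate_root (q := 'X) w0; rewrite map_polyX !rootX; exact.
Qed.

Lemma conjugate_neq0 z w : z != 0 -> conjugate z w -> w != 0.
Proof.
move=> z0 zw; apply: contra z0 => /eqP w0.
case: zw => p p_irr; rewrite w0 => /andP[pz p0].
by apply/eqP/conjugate0; exists p; rewrite ?p0.
Qed.

Let evalC (z : C) : {rmorphism {poly rat} -> C} := horner_eval z \o toC.

Let evalC_polyC z (p : {poly rat}) : map_poly (evalC z) (map_poly polyC p) = toC p.
Proof.
rewrite -map_poly_comp; apply: eq_map_poly => c.
by rewrite /evalC /= map_polyC /horner_eval hornerC.
Qed.

(** Conjugates of [z] satisfy the algebraic relations of [z], where [h(x, y)] is
    encoded with inner variable [x].  The resultant of [h(x, Y)] and [q(Y)] in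
    the variable [Y] is a rational polynomial in [x] that vanishes at [z], hence
    at its conjugate [w]; so [h(w, Y)] and [q(Y)] have a common root.  The
    conditions on the leading coefficient make the resultant commute with the
    specialisations of [x]. *)
Lemma conjugate_common_root (h : {poly {poly rat}}) (q : {poly rat}) z w y :
    conjugate z w -> q != 0 ->
    evalC z (lead_coef h) != 0 -> evalC w (lead_coef h) != 0 ->
    root (map_poly (evalC z) h) y -> root (toC q) y ->
  exists2 y', root (map_poly (evalC w) h) y' & root (toC q) y'.
Proof.
move=> zw q0 hz hw hzy qy.
have resE x : evalC x (lead_coef h) != 0 ->
    evalC x (resultant h (map_poly polyC q))
    = resultant (map_poly (evalC x) h) (toC q).
  move=> hx; rewrite map_resultant ?evalC_polyC //=.
  rewrite lead_coef_map_inj //; last exact: polyC_inj.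
  by rewrite /horner_eval map_polyC hornerC fmorph_eq0 lead_coef_eq0.
have hmap0 x : evalC x (lead_coef h) != 0 -> map_poly (evalC x) h != 0.
  move=> hx; apply/eqP => /polyP/(_ (size h).-1).
  by rewrite coef_map /= coef0 => /eqP; rewrite (negPf hx).
have /(conjugate_root zw) : root (toC (resultant h (map_poly polyC q))) z.
  apply/rootP; rewrite [LHS](resE z hz); apply/eqP; rewrite resultant_eq0.
  rewrite (@root_size_gt1 _ y) ?root_gcd ?hzy //.
  by rewrite gcdp_eq0 negb_and hmap0.
move/rootP; rewrite [LHS](resE w hw) => /eqP; rewrite resultant_eq0 => gcd_gt1.
have [y' y'_root] := closed_rootP _ (negbT (gtn_eqF gcd_gt1)).
by move: y'_root; rewrite root_gcd => /andP[]; exists y'.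
Qed.

(** If [p] and [q] annihilate [a] and [b], the relation used is [p(x + y) = 0],
    which holds at [x = a - b], [y = b]. *)
Lemma conjugateB a b w :
    algebraic_number a -> algebraic_number b -> conjugate (a - b) w ->
  exists a' b', [/\ conjugate a a', conjugate b b' & w = a' - b'].
Proof.
move=> /irreducible_annihilator[p p_irr pa] /irreducible_annihilator[q q_irr qb].
move=> ab_w.
have leadE x : evalC x (lead_coef (poly_XaY p)) != 0.
  rewrite lead_coef_poly_XaY /evalC /= map_polyC /horner_eval hornerC.
  by rewrite fmorph_eq0 lead_coef_eq0 irreducible_poly_neq0.
have rootE x y : root (map_poly (evalC x) (poly_XaY p)) y = root (toC p) (x + y).
  rewrite map_comp_poly rmorphD /= map_polyX map_polyC /= /root !horner_comp.
  by rewrite evalC_polyC !hornerE /evalC /= map_polyX /horner_eval hornerX addrC.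
have [|b'] := conjugate_common_root ab_w (irreducible_poly_neq0 q_irr)
  (leadE _) (leadE _) _ qb.
  by rewrite rootE subrK.
rewrite rootE => pa' qb'; exists (w + b'), b'; split; last by rewrite addrK.
  by exists p; rewrite ?pa.
by exists q; rewrite ?qb.
Qed.

(** Same argument with the relation [p(x * y) = 0] at [x = a / b], [y = b]; its
    leading coefficient in [y] vanishes at [x = 0], whence the separate case. *)
Lemma conjugate_div a b w : b != 0 ->
    algebraic_number a -> algebraic_number b -> conjugate (a / b) w ->
  exists a' b', [/\ conjugate a a', conjugate b b' & w = a' / b'].
Proof.
move=> b_neq0 alg_a alg_b ab_w.
have [a_eq0|a_neq0] := eqVneq a 0.
  have [q q_irr qb] := irreducible_annihilator alg_b.
  move: ab_w; rewrite a_eq0 mul0r => -[p p_irr /andP[p0 pw]].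
  have -> : w = 0 by apply: conjugate0; exists p; rewrite ?p0.
  by exists 0, b; split; [exists p; rewrite ?p0|exists q; rewrite ?qb|rewrite mul0r].
have [p p_irr pa] := irreducible_annihilator alg_a.
have [q q_irr qb] := irreducible_annihilator alg_b.
have ab_neq0 : a / b != 0 by rewrite mulf_neq0 ?invr_eq0.
have leadE x : x != 0 -> evalC x (lead_coef (poly_XmY p)) != 0.
  move=> x_neq0; rewrite lead_coef_comp; last by rewrite size_XmulC ?polyX_eq0.
  rewrite lead_coef_map_inj //; last exact: polyC_inj.
  rewrite [lead_coef ('X * _)]lead_coefM lead_coefX lead_coefC mul1r.
  rewrite /evalC /= rmorphM rmorphXn /= map_polyC map_polyX /horner_eval !hornerE.
  by rewrite mulf_neq0 ?expf_neq0 // fmorph_eq0 lead_coef_eq0 irreducible_poly_neq0.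
have rootE x y : root (map_poly (evalC x) (poly_XmY p)) y = root (toC p) (x * y).
  rewrite map_comp_poly rmorphM /= map_polyX map_polyC /= /root !horner_comp.
  by rewrite evalC_polyC !hornerE /evalC /= map_polyX /horner_eval hornerX mulrC.
have w_neq0 := conjugate_neq0 ab_neq0 ab_w.
have [|b'] := conjugate_common_root ab_w (irreducible_poly_neq0 q_irr)
  (leadE _ ab_neq0) (leadE _ w_neq0) _ qb.
  by rewrite rootE divfK.
rewrite rootE => pa' qb'.
have bb' : conjugate b b' by exists q; rewrite ?qb.
exists (w * b'), b'; split; [by exists p; rewrite ?pa|by []|].
by rewrite mulfK // (conjugate_neq0 b_neq0).
Qed.

Lemma conjugate_inv_bounded b : algebraic_number b ->
  exists2 B : C, 0 <= B & forall b', conjugate b b' -> `|b'^-1| <= B.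
Proof.
case=> q q_neq0 qb.
have [rs def_q] := closed_field_poly_normal (toC q).
have B_ge0 s : 0 <= \sum_(r <- s) `|r^-1| :> C by rewrite sumr_ge0.
exists (\sum_(r <- rs) `|r^-1|) => // b' /conjugate_root/(_ qb).
rewrite def_q rootZ ?lead_coef_eq0 ?map_poly_eq0 // root_prod_XsubC => b'_rs.
by rewrite (big_rem _ b'_rs) /= lerDl.
Qed.

(** The leading coefficient of an integral annihilator is a denominator: if it
    is [d] and the degree is [n], then [d ^ (n - 1)] times the equation is monic
    in [d * z]. *)
Lemma algebraic_denominator z : algebraic_number z ->
  exists2 d : int, d != 0 & algebraic_integer (d%:~R * z).
Proof.
case=> p p_neq0 pz; have [q [a a_neq0 def_p]] := rat_poly_scale p.
have q_neq0 : q != 0.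
  by apply: contraNneq p_neq0 => q0; rewrite def_p q0 rmorph0 scaler0.
exists (lead_coef q); first by rewrite lead_coef_eq0.
have qz : root (map_poly (intr : int -> C) q) z.
  move: pz; rewrite def_p map_polyZ rootZ /=; last first.
    by rewrite fmorph_eq0 invr_eq0 intr_eq0.
  rewrite -map_poly_comp; congr (root _ z); apply: eq_map_poly => c.
  by rewrite /= ratr_int.
pose n := (size q).-1; pose d := lead_coef q.
have size_q : size q = n.+1 by rewrite polySpred.
have n_gt0 : (0 < n)%N.
  rewrite -ltnS -size_q ltnNge; apply/negP => /size1_polyC q_cst.
  move: qz q_neq0; rewrite q_cst map_polyC rootC intr_eq0 => /eqP ->.
  by rewrite polyC0 eqxx.
exists ('X^n + \poly_(i < n) (q`_i * d ^+ (n.-1 - i))).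
  by rewrite monicE lead_coefDl ?lead_coefXn // size_polyXn ltnS size_poly.
have : d%:~R ^+ n.-1 * (map_poly (intr : int -> C) q).[z] = 0.
  by move/rootP: qz => ->; rewrite mulr0.
rewrite (@horner_coef_wide _ n.+1) ?size_map_inj_poly ?size_q //; last first.
  exact: intr_inj.
rewrite big_ord_recr /= mulrDr mulr_sumr => E; apply/rootP; rewrite -[RHS]E.
rewrite rmorphD /= map_polyXn hornerD hornerXn addrC; congr (_ + _); last first.
  by rewrite coef_map /= -lead_coefE -/d mulrA exprMn -exprSr prednK.
rewrite (@horner_coef_wide _ n) ?(leq_trans (size_poly _ _)) ?size_poly //.
apply: eq_bigr => i _; rewrite !coef_map coef_poly ltn_ord /= rmorphM rmorphXn /=.
have -> : d%:~R ^+ n.-1 = d%:~R ^+ (n.-1 - i) * d%:~R ^+ i :> C.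
  by rewrite -exprD subnK // -ltnS prednK.
by rewrite exprMn; ring.
Qed.

End Conjugates.

(** * The field of algebraic numbers *)

Definition is_algebraic (C : numClosedFieldType) : pred C :=
  fun z => `[< algebraic_number z >].

Lemma is_algebraic_divring_closed (C : numClosedFieldType) :
  divring_closed (@is_algebraic C).
Proof.
split=> [|x y /asboolP alg_x /asboolP alg_y|x y /asboolP alg_x /asboolP alg_y].
- by apply/asboolP; apply: algebraic1.
- by apply/asboolP; apply: algebraic_sub.
- by apply/asboolP; apply: algebraic_div.
Qed.

HB.instance Definition _ (C : numClosedFieldType) :=
  GRing.isDivringClosed.Build C (@is_algebraic C) (@is_algebraic_divring_closed C).

(** Linear algebra over [algnum C] turns solvability over [C] into solvability
    with algebraic coefficients. *)
Record algnum (C : numClosedFieldType) :=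
  AlgNum { algnum_val : C; algnum_valP : algnum_val \in @is_algebraic C }.

HB.instance Definition _ (C : numClosedFieldType) :=
  [isSub for @algnum_val C].
HB.instance Definition _ (C : numClosedFieldType) :=
  [Choice of algnum C by <:].
HB.instance Definition _ (C : numClosedFieldType) :=
  [SubChoice_isSubIntegralDomain of algnum C by <:].
HB.instance Definition _ (C : numClosedFieldType) :=
  [SubIntegralDomain_isSubField of algnum C by <:].

(* Simplification unfolds [val] to [algnum_val], which therefore needs the
   morphism structure too. *)
HB.instance Definition _ (C : numClosedFieldType) :=
  GRing.RMorphism.copy (@algnum_val C) (val : algnum C -> C).

Section AlgNum.
Variable C : numClosedFieldType.

Lemma algnum_val_inj : injective (@algnum_val C).
Proof. exact: val_inj. Qed.

Lemma algebraic_algnum (x : algnum C) : algebraic_number (algnum_val x).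
Proof. by apply/asboolP/(valP x). Qed.

Lemma algnum_lift (I : Type) (f : I -> C) : (forall i, algebraic_number (f i)) ->
  exists g : I -> algnum C, forall i, algnum_val (g i) = f i.
Proof.
by move=> alg_f; exists (fun i => AlgNum (asboolT (alg_f i))).
Qed.

End AlgNum.

(** * Power series satisfying linear differential equations *)

(** An alias for sequences of coefficients, so that it can carry the
    [{poly k}]-module structure of [k[[z]]]. *)
Definition pser (k : fieldType) : Type := nat -> k.

HB.instance Definition _ (k : fieldType) := GRing.Zmodule.on (pser k).

Section PowerSeries.
Variable k : fieldType.
Implicit Types (f g : pser k) (p q : {poly k}).

Lemma pserP f g : (forall n, f n = g n) <-> f = g.
Proof. by split=> [fg|->//]; apply/funext. Qed.

Lemma pserD f g n : (f + g) n = f n + g n. Proof. by []. Qed.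

Definition pser_trunc f n : {poly k} := \poly_(i < n) f i.

(** Truncating [f] makes the product one of polynomials, from which the module
    axioms and the Leibniz rule are inherited. *)
Definition pser_scale p f : pser k := fun n => (p * pser_trunc f n.+1)`_n.

Lemma pser_scaleE p f n :
  pser_scale p f n = \sum_(i < n.+1) p`_i * f (n - i)%N.
Proof.
rewrite /pser_scale coefM; apply: eq_bigr => i _.
by rewrite coef_poly ltnS leq_subr.
Qed.

Lemma pser_scale_trunc p f m n : (n < m)%N ->
  pser_scale p f n = (p * pser_trunc f m)`_n.
Proof.
move=> nm; rewrite pser_scaleE coefM; apply: eq_bigr => i _.
by rewrite coef_poly (leq_ltn_trans (leq_subr _ _) nm).
Qed.

Lemma pser_scaleA p q f : pser_scale p (pser_scale q f) = pser_scale (p * q) f.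
Proof.
apply/pserP => n; rewrite [RHS]/pser_scale -mulrA pser_scaleE coefM.
apply: eq_bigr => i _; congr (_ * _); apply: pser_scale_trunc.
by rewrite ltnS leq_subr.
Qed.

Lemma pser_scale1 : left_id 1 pser_scale.
Proof. by move=> f; apply/pserP => n; rewrite /pser_scale mul1r coef_poly ltnSn. Qed.

Lemma pser_scaleDr : right_distributive pser_scale +%R.
Proof.
move=> p f g; apply/pserP => n.
rewrite pserD !pser_scaleE -big_split /=.
by apply: eq_bigr => i _; rewrite pserD mulrDr.
Qed.

Lemma pser_scaleDl f : {morph pser_scale^~ f : p q / p + q}.
Proof.
move=> p q; apply/pserP => n.
rewrite pserD !pser_scaleE -big_split /=.
by apply: eq_bigr => i _; rewrite coefD mulrDl.
Qed.

HB.instance Definition _ := GRing.Zmodule_isLmodule.Build {poly k} (pser k)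
  pser_scaleA pser_scale1 pser_scaleDr pser_scaleDl.

Definition pser_deriv f : pser k := fun n => n.+1%:R * f n.+1.

Lemma pser_derivE f n : pser_deriv f n = n.+1%:R * f n.+1. Proof. by []. Qed.

Lemma pserZE p f n : (p *: f) n = pser_scale p f n. Proof. by []. Qed.

Lemma pser_deriv_is_zmod_morphism : zmod_morphism pser_deriv.
Proof. by move=> f g; apply/pserP => n; apply: mulrBr. Qed.

HB.instance Definition _ :=
  GRing.isZmodMorphism.Build (pser k) (pser k) pser_deriv
    pser_deriv_is_zmod_morphism.

Lemma pser_derivZ p f : pser_deriv (p *: f) = p^`() *: f + p *: pser_deriv f.
Proof.
apply/pserP => n; rewrite pserD !pserZE pser_derivE pserZE.
rewrite (@pser_scale_trunc _ _ n.+2) // mulr_natl -coef_deriv derivM coefD.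
rewrite -pser_scale_trunc //; congr (_ + _).
rewrite [RHS]/pser_scale; congr (nth 0 (polyseq (_ * _)) n); apply/polyP => i.
rewrite coef_deriv !coef_poly ltnS pser_derivE.
by case: ifP; rewrite ?mul0rn ?mulr_natl.
Qed.

Definition op_apply (P : {poly {poly k}}) f : pser k :=
  \sum_(j < size P) P`_j *: iter j pser_deriv f.

Lemma op_apply_wide m (P : {poly {poly k}}) f : (size P <= m)%N ->
  op_apply P f = \sum_(j < m) P`_j *: iter j pser_deriv f.
Proof.
move=> Pm; rewrite /op_apply -!(big_mkord xpredT (fun j => P`_j *: iter j _ f)).
rewrite [RHS](big_cat_nat (leq0n _) Pm) /= [X in _ + X]big1_seq ?addr0 // => j.
by rewrite mem_index_iota => /andP[_ /andP[Pj _]]; rewrite nth_default ?scale0r.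
Qed.

(** Up to the denominator [q], [f] lies in the span of a finite family [Y]
    whose derivatives lie in the span of [Y]. *)
Definition D_finite f : Prop := exists N (Y : 'I_N -> pser k) (q : {poly k})
    (B : 'M[{poly k}]_N) (v : 'rV[{poly k}]_N),
  [/\ q != 0, forall i, q *: pser_deriv (Y i) = \sum_j B i j *: Y j
    & q *: f = \sum_j v 0 j *: Y j].

(** The family is [f, f', ..., f^(m-1)] with [m] the order of the operator, and
    [B] is its companion matrix.  For [m = 0] the family is empty and [q f = 0],
    which is why the definition allows a denominator in front of [f]. *)
Lemma D_finite_op (P : {poly {poly k}}) f :
  P != 0 -> op_apply P f = 0 -> D_finite f.
Proof.
move=> P0 Pf; pose m := (size P).-1; pose q := lead_coef P.
have size_P : size P = m.+1 by rewrite polySpred.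
pose Y (i : 'I_m) : pser k := iter i pser_deriv f.
exists m, Y, q, (\matrix_(i, j) if i.+1 == m then - P`_j
                 else if j == i.+1 :> nat then q else 0),
  (\row_j if j == 0 :> nat then q else 0).
split=> [|i|]; first by rewrite lead_coef_eq0.
- have [im|im] := eqVneq i.+1 m.
    rewrite (eq_bigr (fun j : 'I_m => - (P`_j *: Y j))) => [|j _]; last first.
      by rewrite mxE im eqxx scaleNr.
    rewrite sumrN; apply/eqP; rewrite -addr_eq0 addrC; apply/eqP.
    rewrite -[RHS]Pf (@op_apply_wide m.+1) ?size_P // big_ord_recr /=.
    by congr (_ + _); rewrite -[in iter m _ _]im.
  have lt_im : (i.+1 < m)%N by rewrite ltn_neqAle im ltn_ord.
  rewrite (bigD1 (Ordinal lt_im)) //= mxE (negPf im) eqxx big1 ?addr0 //.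
  by move=> j ji; rewrite mxE (negPf im) -val_eqE /= in ji *; rewrite (negPf ji) scale0r.
- case: m @Y size_P => [|m] Y size_P.
    by rewrite big_ord0 -[RHS]Pf /op_apply size_P big_ord1 /q lead_coefE size_P.
  rewrite (bigD1 ord0) //= mxE eqxx big1 ?addr0 // => j j0.
  by rewrite mxE -val_eqE /= in j0 *; rewrite (negPf j0) scale0r.
Qed.

Lemma D_finiteB f g : D_finite f -> D_finite g -> D_finite (f - g).
Proof.
move=> [N1 [Y1 [q1 [B1 [v1 [q10 DY1 fE]]]]]] [N2 [Y2 [q2 [B2 [v2 [q20 DY2 gE]]]]]].
pose Y (i : 'I_(N1 + N2)) := match fintype.split i with inl j => Y1 j | inr j => Y2 j end.
have Yl i : Y (lshift N2 i) = Y1 i by rewrite /Y (unsplitK (inl i)).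
have Yr i : Y (rshift N1 i) = Y2 i by rewrite /Y (unsplitK (inr i)).
exists (N1 + N2)%N, Y, (q1 * q2), (block_mx (q2 *: B1) 0 0 (q1 *: B2)),
  (row_mx (q2 *: v1) (- q1 *: v2)).
split; first by rewrite mulf_neq0.
- move=> i; rewrite big_split_ord /=; case: (split_ordP i) => j ->.
    rewrite Yl mulrC -scalerA DY1 scaler_sumr [X in _ + X]big1 ?addr0 => [|l _].
      by apply: eq_bigr => l _; rewrite block_mxEul mxE Yl scalerA.
    by rewrite block_mxEur mxE scale0r.
  rewrite Yr -scalerA DY2 scaler_sumr [X in X + _]big1 ?add0r => [|l _].
    by apply: eq_bigr => l _; rewrite block_mxEdr mxE Yr scalerA.
  by rewrite block_mxEdl mxE scale0r.
- rewrite big_split_ord scalerBr {1}mulrC -!scalerA fE gE !scaler_sumr -sumrN /=.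
  congr (_ + _); apply: eq_bigr => j _.
    by rewrite row_mxEl Yl mxE scalerA.
  by rewrite row_mxEr Yr mxE scalerA mulNr scaleNr.
Qed.

Lemma span_deriv N (Y : 'I_N -> pser k) (q : {poly k}) (B : 'M[{poly k}]_N)
    (w : 'rV[{poly k}]_N) (g : pser k) :
    (forall i, q *: pser_deriv (Y i) = \sum_j B i j *: Y j) ->
    g = \sum_j w 0 j *: Y j ->
  q *: pser_deriv g = \sum_j (q *: map_mx deriv w + w *m B) 0 j *: Y j.
Proof.
move=> DY ->; rewrite raddf_sum scaler_sumr /=.
under eq_bigr => i _.
  rewrite pser_derivZ scalerDr !scalerA [q * w 0 i]mulrC.
  rewrite -[(w 0 i * q) *: _]scalerA DY scaler_sumr.
over.
rewrite big_split exchange_big -big_split /=; apply: eq_bigr => j _.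
rewrite !mxE scalerDl scaler_suml; congr (_ + _); apply: eq_bigr => i _.
by rewrite scalerA.
Qed.

Lemma rowB N (u w : 'rV[{poly k}]_N) (c : {poly k}) j :
  (u - c *: w) 0 j = u 0 j - c * w 0 j.
Proof. by rewrite !mxE. Qed.

Lemma D_finite_deriv f : D_finite f -> D_finite (pser_deriv f).
Proof.
move=> [N [Y [q [B [v [q0 DY fE]]]]]].
exists N, Y, (q ^+ 2), (q *: B), (q *: map_mx deriv v + v *m B - q^`() *: v).
split=> [|i|]; first by rewrite expf_neq0.
  rewrite -scalerA DY scaler_sumr; apply: eq_bigr => j _.
  by rewrite mxE scalerA.
have := span_deriv DY fE.
rewrite pser_derivZ scalerDr !scalerA [q * q^`()]mulrC.
rewrite -[(q^`() * q) *: f]scalerA fE.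
move/(canRL (addKr _)); rewrite -expr2 => ->.
rewrite addrC scaler_sumr -sumrB; apply: eq_bigr => j _.
by rewrite scalerA -scalerBl rowB.
Qed.

Lemma D_finiteZ p f : D_finite f -> D_finite (p *: f).
Proof.
move=> [N [Y [q [B [v [q0 DY fE]]]]]]; exists N, Y, q, B, (p *: v); split=> //.
rewrite scalerA mulrC -scalerA fE scaler_sumr; apply: eq_bigr => j _.
by rewrite mxE scalerA.
Qed.

(** The [N + 1] series [q^(n+1) f^(n)], [n <= N], lie in the span of a family of
    [N] elements, so they satisfy a nontrivial linear relation over [k[z]]. *)
Lemma D_finite_annihilated f : D_finite f ->
  exists2 P : {poly {poly k}}, P != 0 & op_apply P f = 0.
Proof.
move=> [N [Y [q [B [v [q0 DY fE]]]]]].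
have : forall n, exists w : 'rV_N,
    q ^+ n.+1 *: iter n pser_deriv f = \sum_j w 0 j *: Y j.
  elim=> [|n [w wE]]; first by exists v.
  exists (q *: map_mx deriv w + w *m B - (q^`() *+ n.+1) *: w).
  have := span_deriv DY wE; rewrite pser_derivZ scalerDr !scalerA -exprS.
  have -> : q * (q ^+ n.+1)^`() = (q^`() *+ n.+1) * q ^+ n.+1.
    by rewrite deriv_exp exprS /= -!mulrnAl; ring.
  rewrite -[(_ * q ^+ n.+1) *: _]scalerA wE => /(canRL (addKr _)) ->.
  rewrite addrC scaler_sumr -sumrB; apply: eq_bigr => j _.
  by rewrite scalerA -scalerBl rowB.
move=> /choice[w wE].
(* A zero last column makes the system square, so that the determinant gives
   a relation over the domain [{poly k}]. *)
pose W : 'M[{poly k}]_N.+1 :=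
  \matrix_(i, j) if unlift ord_max j is Some l then w i 0 l else 0.
have : \det W = 0.
  rewrite (expand_det_col _ ord_max) big1 // => i _.
  by rewrite mxE unlift_none mul0r.
move=> /eqP/det0P[c c0 cW].
pose P : {poly {poly k}} := \poly_(i < N.+1) (c 0 (inord i) * q ^+ i.+1).
exists P.
  apply: contraNneq c0 => P0; apply/eqP/rowP => i.
  have /polyP/(_ i) := P0; rewrite coef_poly ltn_ord inord_val coef0 mxE => /eqP.
  by rewrite mulf_eq0 expf_eq0 (negPf q0) andbF orbF => /eqP.
rewrite (@op_apply_wide N.+1) ?size_poly //.
under eq_bigr => i _.
  rewrite coef_poly ltn_ord inord_val -scalerA wE scaler_sumr.
over.
rewrite exchange_big big1 // => j _ /=.
under eq_bigr => i _ do rewrite scalerA.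
rewrite -scaler_suml; move/rowP/(_ (lift ord_max j)): cW; rewrite mxE.
under eq_bigr => i _ do rewrite mxE liftK.
by move=> ->; rewrite mxE scale0r.
Qed.

End PowerSeries.

(** * E-functions form a differential vector space over the algebraic numbers *)

Section EFunctions.
Variable C : numClosedFieldType.
Local Notation algnum := (algnum C).
Local Notation toC := (@algnum_val C).

Lemma algebraic_rat (q : rat) : algebraic_number (ratr q : C).
Proof. exact: algebraic_id. Qed.

Lemma algebraic_nat n : algebraic_number (n%:R : C).
Proof. by rewrite -ratr_nat; exact: algebraic_rat. Qed.

Lemma op_apply_val (P : {poly {poly algnum}}) (h : pser algnum) n :
  diffop_ps (map_poly (map_poly toC) P) (toC \o h) n = toC (op_apply P h n).
Proof.
have derivE j m : iter j (@ps_deriv C) (toC \o h) m = toC (iter j (@pser_deriv _) h m).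
  elim: j m => // j IH m; rewrite !iterS /ps_deriv IH pser_derivE.
  by rewrite rmorphM rmorph_nat.
have -> : op_apply P h n = \sum_(j < size P) (P`_j *: iter j (@pser_deriv _) h) n.
  by rewrite /op_apply; elim/big_ind2: _ => // x a y b <- <-.
rewrite /diffop_ps size_map_inj_poly ?rmorph0 //; last first.
  exact/map_inj_poly/rmorph0/algnum_val_inj.
rewrite rmorph_sum; apply: eq_bigr => j _.
rewrite pserZE pser_scaleE rmorph_sum; apply: eq_bigr => i _.
by rewrite derivE rmorphM !coef_map_id0 ?rmorph0.
Qed.

Lemma diffop_lift (P : diffop C) : algebraic_diffop P ->
  exists Q : {poly {poly algnum}}, map_poly (map_poly toC) Q = P.
Proof.
move=> algP.
have [g gE] := algnum_lift (f := fun ji : nat * nat => (P`_ji.1)`_ji.2)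
  (fun ji => algP ji.2 ji.1).
exists (\poly_(j < size P) \poly_(i < size P`_j) g (j, i)).
apply/polyP => j; rewrite coef_map_id0 ?rmorph0 // coef_poly.
case: ltnP => [jP|Pj]; last by rewrite rmorph0 nth_default.
apply/polyP => i; rewrite coef_map_id0 ?rmorph0 // coef_poly.
by case: ltnP => [iP|Pi]; rewrite ?gE // rmorph0 nth_default.
Qed.

(** The arithmetic half of the definition of an E-function [f], for the
    numerators [a n = n! * f n]. *)
Definition house_denominator_bounded (a : nat -> C) (c : C) : Prop :=
  [/\ 0 < c, forall n w, conjugate (a n) w -> `|w| <= c ^+ n.+1
    & exists d : nat -> int,
        [/\ forall n, d n != 0, forall n, `|(d n)%:~R| <= c ^+ n.+1 :> C
          & forall n m, (m <= n)%N -> algebraic_integer ((d n)%:~R * a m)]].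

(** Separates the arithmetic conditions from the differential equation, and
    descends the latter to the field of algebraic numbers. *)
Lemma E_functionP (f : nat -> C) : E_function f <->
  exists (h : pser algnum) (c : C), [/\ forall n, f n = toC (h n), D_finite h
    & house_denominator_bounded (fun n => f n * n`!%:R) c].
Proof.
have fact0 n : n`!%:R != 0 :> C by rewrite pnatr_eq0 -lt0n fact_gt0.
split=> [[a [c [[fE alg_a] c0 conj_a [d [d0 dc d_int]] [P [P0 algP Pf]]]]]|].
  have aE n : f n * n`!%:R = a n by rewrite fE divfK.
  have [|h hE] := @algnum_lift C _ f.
    by move=> n; rewrite fE; exact: algebraic_div (alg_a n) (algebraic_nat _).
  exists h, c; split=> [n| |]; first by rewrite hE.
    have [Q QP] := diffop_lift algP; apply: (@D_finite_op _ Q).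
      by apply: contraNneq P0 => Q0; rewrite -QP Q0 rmorph0.
    apply/pserP => n; apply: algnum_val_inj; rewrite -op_apply_val QP.
    rewrite (_ : toC \o h = f) ?Pf ?rmorph0 //.
    by apply/funext => m /=.
  split=> // [n w|]; first by rewrite aE; exact: conj_a.
  by exists d; split=> // n m; rewrite aE; exact: d_int.
move=> [h [c [fE hfin [c0 conj_a [d [d0 dc d_int]]]]]].
exists (fun n => f n * n`!%:R), c; split=> //.
- split=> n; first by rewrite mulfK.
  by rewrite fE; exact: algebraic_mul (algebraic_algnum _) (algebraic_nat _).
- by exists d.
- have [P P0 Ph] := D_finite_annihilated hfin.
  have valP_inj : injective (map_poly toC).
    exact/map_inj_poly/rmorph0/algnum_val_inj.
  exists (map_poly (map_poly toC) P); split=> [|i j|n].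
  + rewrite map_poly_eq0_id0 // -(rmorph0 (map_poly toC)) (inj_eq valP_inj).
    by rewrite lead_coef_eq0.
  + by rewrite !coef_map_id0 ?rmorph0 //; exact: algebraic_algnum.
  + have -> : f = toC \o h by apply/funext.
    by rewrite op_apply_val Ph rmorph0.
Qed.

Lemma E_function_algebraic f n : E_function f -> algebraic_number (f n : C).
Proof. by move=> /E_functionP[h [c [-> _ _]]]; exact: algebraic_algnum. Qed.

Lemma house_denominator_boundedB a b c1 c2 :
    (forall n, algebraic_number (a n)) -> (forall n, algebraic_number (b n)) ->
    house_denominator_bounded a c1 -> house_denominator_bounded b c2 ->
  house_denominator_bounded (fun n => a n - b n) (c1 + c2 + c1 * c2).
Proof.
move=> alg_a alg_b [c10 conj_a [d [d0 dc d_int]]] [c20 conj_b [e [e0 ec e_int]]].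
have c1_ge0 := ltW c10; have c2_ge0 := ltW c20.
have c120 : 0 <= c1 * c2 by rewrite mulr_ge0.
have powD n : c1 ^+ n.+1 + c2 ^+ n.+1 <= (c1 + c2) ^+ n.+1.
  rewrite [leRHS]exprS mulrDl !exprS lerD // ler_wpM2l // lerXn2r ?nnegrE ?addr_ge0 //.
    by rewrite lerDl.
  by rewrite lerDr.
split; first by rewrite !addr_gt0 ?mulr_gt0.
  move=> n w /(conjugateB (alg_a n) (alg_b n))[a' [b' [/conj_a ha /conj_b hb ->]]].
  apply: le_trans (ler_normB _ _) _; apply: le_trans (lerD ha hb) _.
  apply: le_trans (powD n) _; rewrite lerXn2r ?nnegrE ?addr_ge0 //.
  by rewrite lerDl.
exists (fun n => d n * e n); split=> [n|n|n m mn].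
- by rewrite mulf_neq0.
- rewrite rmorphM normrM; apply: le_trans (ler_pM _ _ (dc n) (ec n)) _ => //.
  rewrite -exprMn lerXn2r ?nnegrE ?addr_ge0 //.
  by rewrite lerDr addr_ge0.
- have -> : (d n * e n)%:~R * (a m - b m) =
    (e n)%:~R * ((d n)%:~R * a m) - (d n)%:~R * ((e n)%:~R * b m) :> C.
    by rewrite rmorphM /=; ring.
  apply: integral_sub.
    by apply: integral_mul (d_int _ _ mn); exact: integral_id.
  by apply: integral_mul (e_int _ _ mn); exact: integral_id.
Qed.

(** Writing [l * a n = a n / l^-1], the conjugates are the quotients [a' / l'],
    and [1 / l'] is bounded since [l^-1] has finitely many conjugates. *)
Lemma house_denominator_boundedZ (l : C) a c :
    l != 0 -> algebraic_number l -> (forall n, algebraic_number (a n)) ->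
    house_denominator_bounded a c ->
  exists c', house_denominator_bounded (fun n => l * a n) c'.
Proof.
move=> l0 alg_l alg_a [c0 conj_a [d [d0 dc d_int]]]; have c_ge0 := ltW c0.
have alg_lV : algebraic_number l^-1 by exact: algebraic_inv.
have [B B0 conj_l] := conjugate_inv_bounded alg_lV.
have [e e0 e_int] := algebraic_denominator alg_l.
pose K : C := 1 + B + `|e%:~R|.
have K_ge1 : 1 <= K by rewrite /K -addrA lerDl addr_ge0.
have powK n : K * c ^+ n.+1 <= (K * c) ^+ n.+1.
  rewrite exprMn ler_wpM2r ?exprn_ge0 // exprS ler_peMr ?exprn_ege1 //.
  by rewrite (le_trans ler01).
exists (K * c); split; first by rewrite mulr_gt0 // (lt_le_trans ltr01).
  move=> n w; have -> : l * a n = a n / l^-1 by rewrite invrK mulrC.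
  move=> /conjugate_div[||//|a' [l' [/conj_a ha /conj_l hl ->]]]; rewrite ?invr_eq0 //.
  rewrite mulrC normrM; apply: le_trans (ler_pM _ _ hl ha) (le_trans _ (powK n)) => //.
  by rewrite ler_wpM2r ?exprn_ge0 // /K -addrA addrCA lerDl addr_ge0.
exists (fun n => e * d n); split=> [n|n|n m mn].
- by rewrite mulf_neq0.
- rewrite rmorphM normrM.
  apply: le_trans (ler_pM _ _ (lexx _) (dc n)) (le_trans _ (powK n)) => //.
  by rewrite ler_wpM2r ?exprn_ge0 // /K lerDr addr_ge0.
- rewrite rmorphM /= mulrACA; apply: integral_mul => //; exact: d_int.
Qed.

Lemma house_denominator_boundedS a c :
  house_denominator_bounded a c ->
  house_denominator_bounded (fun n => a n.+1) ((1 + c) * c).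
Proof.
move=> [c0 conj_a [d [d0 dc d_int]]]; have c_ge0 := ltW c0.
have powS n : c ^+ n.+2 <= ((1 + c) * c) ^+ n.+1.
  rewrite exprMn [leLHS]exprS ler_wpM2r ?exprn_ge0 //.
  rewrite exprS; apply: (@le_trans _ _ (1 + c)); first by rewrite lerDr.
  by rewrite ler_peMr ?exprn_ege1 ?addr_ge0 // lerDl.
split; first by rewrite mulr_gt0 ?addr_gt0.
  by move=> n w /conj_a ha; exact: le_trans ha (powS n).
exists (fun n => d n.+1); split=> // [n|n m mn]; first exact: le_trans (dc _) (powS n).
exact: d_int.
Qed.

Lemma E_functionB (f g : nat -> C) : E_function f -> E_function g ->
  E_function (fun n => f n - g n).
Proof.
move=> Ef Eg.
have /E_functionP[h1 [c1 [f1 fin1 bnd1]]] := Ef.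
have /E_functionP[h2 [c2 [f2 fin2 bnd2]]] := Eg.
apply/E_functionP; exists (h1 - h2), (c1 + c2 + c1 * c2); split=> [n||].
- by rewrite f1 f2 -rmorphB.
- exact: D_finiteB.
- under eq_fun do rewrite mulrBl.
  apply: house_denominator_boundedB => // n.
    exact: algebraic_mul (E_function_algebraic _ Ef) (algebraic_nat _).
  exact: algebraic_mul (E_function_algebraic _ Eg) (algebraic_nat _).
Qed.

Lemma E_function0 : E_function (fun=> 0 : C).
Proof.
exists (fun=> 0), 1; split=> //.
- by split=> n; [rewrite mul0r|exact: (algebraic_nat 0)].
- move=> n w /conjugate0 ->; by rewrite normr0 expr1n.
- exists (fun=> 1); split=> // n; first by rewrite normr1 expr1n.
  by move=> m _; rewrite mulr0; exists 'X; rewrite ?monicX ?map_polyX ?rootX.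
- exists 1; split=> [|i j|n]; first exact: oner_neq0.
    rewrite coef1; case: (_ == 0)%N; first by rewrite coef1; exact: algebraic_nat.
    by rewrite coef0; exact: (algebraic_nat 0).
  rewrite /diffop_ps big1 // => j _; rewrite big1 // => i _.
  have derivE l m : iter l (@ps_deriv C) (fun=> 0) m = 0.
    by elim: l m => //= l IH m; rewrite /ps_deriv IH mulr0.
  by rewrite derivE mulr0.
Qed.

Lemma E_functionZ (l : C) (f : nat -> C) : algebraic_number l ->
  E_function f -> E_function (fun n => l * f n).
Proof.
move=> alg_l Ef; have [->|l0] := eqVneq l 0.
  by under eq_fun do rewrite mul0r; exact: E_function0.
have /E_functionP[h [c [fE fin bnd]]] := Ef.
have [|c' bnd'] := house_denominator_boundedZ l0 alg_l _ bnd.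
  move=> n; exact: algebraic_mul (E_function_algebraic n Ef) (algebraic_nat _).
have [g gE] := @algnum_lift C unit (fun=> l) (fun=> alg_l).
apply/E_functionP; exists ((g tt)%:P *: h), c'; split=> [n||].
- by rewrite pserZE /pser_scale mul_polyC coefZ coef_poly ltnSn rmorphM /= gE fE.
- exact: D_finiteZ.
- by under eq_fun do rewrite -mulrA.
Qed.

Lemma E_functionD (f g : nat -> C) : E_function f -> E_function g ->
  E_function (fun n => f n + g n).
Proof.
move=> Ef Eg.
have algN1 : algebraic_number (-1 : C) by apply: algebraic_opp; exact: (algebraic_nat 1).
have := E_functionB Ef (E_functionZ algN1 Eg).
by under eq_fun do rewrite mulN1r opprK.
Qed.

Lemma E_function_deriv (f : nat -> C) : E_function f -> E_function (ps_deriv f).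
Proof.
move=> /E_functionP[h [c [fE fin bnd]]].
apply/E_functionP; exists (pser_deriv h), ((1 + c) * c); split=> [n||].
- by rewrite /ps_deriv pser_derivE fE rmorphM rmorph_nat.
- exact: D_finite_deriv.
- rewrite (_ : (fun n => _) = (fun n => f n.+1 * n.+1`!%:R)).
    exact: (house_denominator_boundedS bnd).
  by apply/funext => n; rewrite /ps_deriv factS natrM; ring.
Qed.

End EFunctions.

(** * Series and derivatives in the complex plane *)

Section ComplexSeries.
Variable R : realType.
Local Notation K := (CC R).
Local Notation rc := (real_complex R).

Lemma norm_real_complex (x : R) : `|rc x : K| = rc `|x|.
Proof. by rewrite [LHS]normc_def /= expr0n addr0 sqrtr_sqr. Qed.

Lemma norm_complex_i : `|'i%C : K| = 1.
Proof. by rewrite [LHS]normc_def /= expr0n expr1n add0r sqrtr1. Qed.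

Lemma normc_ge_Im (z : K) : rc `|complex.Im z| <= `|z|.
Proof.
by rewrite [leRHS]normc_def lecR -sqrtr_sqr ler_wsqrtr // lerDr sqr_ge0.
Qed.

Lemma real_complex_ge0 (x : K) : 0 <= x -> exists2 r : R, 0 <= r & x = rc r.
Proof.
move=> x0; exists (complex.Re x); last by rewrite RRe_real //; exact: ger0_real.
by rewrite -lecR RRe_real; [exact: x0|exact: ger0_real].
Qed.

Lemma cvg_series_abs_bounded_real (v : nat -> R) (M : R) :
  (forall n, \sum_(0 <= i < n) `|v i| <= M) -> cvgn (series v).
Proof.
move=> vM; apply: normed_cvg; apply: nondecreasing_is_cvgn.
  by apply: nondecreasing_series => n _ _; exact: normr_ge0.
by exists M => _ [n _ <-]; exact: vM.
Qed.

(** Completeness of [R[i]], in the form needed here: the real and imaginary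
    parts of the series converge absolutely. *)
Lemma cvg_series_norm_bounded (u : nat -> K) (M : K) :
  (forall n, \sum_(0 <= i < n) `|u i| <= M) -> cvgn (series u).
Proof.
move=> uM; have [|m m0 defM] := @real_complex_ge0 M.
  by have := uM 0%N; rewrite big_nil.
have cvg_part (p : K -> R) : (forall z, rc `|p z| <= `|z|) ->
    cvgn (series (fun n => p (u n))).
  move=> pE; apply: (@cvg_series_abs_bounded_real _ m) => n.
  rewrite -lecR -defM; apply: le_trans (uM n).
  rewrite [leLHS]rmorph_sum; apply: ler_sum => i _; exact: pE.
have cvgRe := cvg_part (@complex.Re R) (@normc_ge_Re R).
have cvgIm := cvg_part (@complex.Im R) normc_ge_Im.
set a := limn (series _) in cvgRe; set b := limn (series _) in cvgIm.
apply/cvg_ex; exists (rc a + 'i%C * rc b : K).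
apply/cvgrPdist_le => e e0.
have [|r r0 defe] := @real_complex_ge0 e; first exact: ltW.
have r_gt0 : 0 < r by rewrite -ltcR -defe.
have r2_gt0 : 0 < r / 2 by rewrite divr_gt0.
near=> n.
have -> : series u n = rc (series (fun n => complex.Re (u n)) n)
    + 'i%C * rc (series (fun n => complex.Im (u n)) n) :> K.
  rewrite /series !rmorph_sum mulr_sumr -big_split /=.
  by apply: eq_bigr => i _; exact: complexE.
rewrite opprD addrACA -mulrBr -!rmorphB.
apply: le_trans (ler_normD _ _) _; rewrite normrM norm_complex_i mul1r.
rewrite !norm_real_complex -rmorphD defe lecR (splitr r) lerD //.
  by near: n; move/cvgrPdist_le: cvgRe; exact.
by near: n; move/cvgrPdist_le: cvgIm; exact.
Unshelve. all: by end_near. Qed.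

Lemma norm_lim_le (u : nat -> K) (l M : K) :
  u @ \oo --> l -> (forall n, `|u n| <= M) -> `|l| <= M.
Proof.
move=> ul uM.
have M0 : 0 <= M := le_trans (normr_ge0 _) (uM 0%N).
rewrite real_leNgt ?ger0_real //; apply/negP => Ml.
have /cvgrPdist_lt/(_ (`|l| - M)) := ul; rewrite subr_gt0 => /(_ Ml)[N _ /(_ N)].
move=> /(_ (leqnn N)) /= lN.
have : `|l| <= `|u N| + `|l - u N| by rewrite -[in leLHS](subrKC (u N) l) ler_normD.
move=> /le_lt_trans /(_ (ler_ltD (uM N) lN)).
by rewrite addrC subrK ltxx.
Qed.

End ComplexSeries.

Section Slopes.
Variable K : numFieldType.
Implicit Types (f g : K -> K) (x a : K).

(** Caratheodory's criterion: the derivative is the value at [x] of a slope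
    function continuous at [x]. *)
Lemma is_derive_of_slope f g x :
  (\forall z \near x, f z - f x = g z * (z - x)) -> {for x, continuous g} ->
  is_derive x 1 f (g x).
Proof.
move=> fE gc.
suff fa : (fun h : K => h^-1 *: (f (h *: 1 + x) - f x)) @ 0^' --> g x.
  by apply: DeriveDef; [apply/cvg_ex; exists (g x)|exact/norm_cvg_lim].
have shiftx : (fun h : K => h + x) @ 0^' --> x.
  by apply/(continuous_withinNshiftx idfun); exact: cvg_id.
have := (continuous_withinNshiftx g x).2 gc.
apply: cvg_trans; apply: near_eq_cvg.
near=> h; rewrite /= [h *: 1]mulr1.
have -> : f (h + x) - f x = g (h + x) * (h + x - x) by near: h; exact: (shiftx _ fE).
rewrite addrK [RHS]mulrC mulfK //; near: h; exact: nbhs_dnbhs_neq.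
Unshelve. all: by end_near. Qed.

Lemma slope_of_is_derive f x a : is_derive x 1 f a ->
  exists g, [/\ forall z, f z - f x = g z * (z - x), {for x, continuous g}
    & g x = a].
Proof.
move=> [fx <-]; set a' := 'D_1 f x.
pose g z := if z == x then a' else (f z - f x) / (z - x).
exists g; split; last by rewrite /g eqxx.
  move=> z; rewrite /g; case: eqP => [->|/eqP zx]; first by rewrite !subrr mulr0.
  by rewrite divfK // subr_eq0.
apply/continuous_withinNshiftx; rewrite {2}/g eqxx.
have : (fun h : K => h^-1 *: (f (h *: 1 + x) - f x)) @ 0^' --> a' by exact: fx.
apply: cvg_trans; apply: near_eq_cvg.
near=> h; rewrite /= [h *: 1]mulr1 /g addrK ifN; first by rewrite mulrC.
rewrite -subr_eq0 addrK; near: h; exact: nbhs_dnbhs_neq.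
Unshelve. all: by end_near. Qed.

Lemma is_derive_comp f g x a b :
  is_derive (g x) 1 f a -> is_derive x 1 g b -> is_derive x 1 (f \o g) (a * b).
Proof.
move=> /slope_of_is_derive[p [fp pc <-]] dg.
have gc : {for x, continuous g}.
  have dg_ex : derivable g x 1 by case: dg.
  exact: differentiable_continuous ((derivable1_diffP g x).1 dg_ex).
have [q [gq qc <-]] := slope_of_is_derive dg.
apply: (is_derive_of_slope (g := fun z => p (g z) * q z)).
  by near=> z; rewrite /= fp gq mulrA.
exact: (continuousM (continuous_comp gc pc) qc).
Unshelve. all: by end_near. Qed.

(** If [p] is the slope of [f] at [g x], then [1 / p (g z)] is the slope of [g]
    at [x], and it is continuous because [g] is. *)
Lemma is_derive_right_inverse f g x a : a != 0 ->
    (\forall z \near x, f (g z) = z) -> {for x, continuous g} ->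
    is_derive (g x) 1 f a ->
  is_derive x 1 g a^-1.
Proof.
move=> a0 fg gc /slope_of_is_derive[p [fp pc pa]].
have pgc : {for x, continuous (p \o g)} by exact: (continuous_comp gc pc).
rewrite -pa; apply: (is_derive_of_slope (g := fun z => (p (g z))^-1)); last first.
  by apply: (continuousV _ pgc); rewrite /= pa.
have pg0 : \forall z \near x, p (g z) != 0.
  apply: (@cvgr_neq0 _ _ _ _ _ (p \o g) _ pgc).
  by rewrite /= pa.
near=> z.
have <- : f (g z) - f (g x) = z - x.
  by rewrite (nbhs_singleton fg); congr (_ - _); near: z.
by rewrite fp mulKf //; near: z.
Unshelve. all: by end_near. Qed.

Lemma is_derive_of_quadratic f x a M :
  (\forall z \near x, `|f z - f x - a * (z - x)| <= M * `|z - x| ^+ 2) ->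
  is_derive x 1 f a.
Proof.
move=> fM.
pose g z := if z == x then a else (f z - f x) / (z - x).
have -> : a = g x by rewrite /g eqxx.
apply: is_derive_of_slope.
  near=> z; rewrite /g; case: eqP => [->|/eqP zx].
    by rewrite !subrr mulr0.
  by rewrite divfK // subr_eq0.
apply/(@cvgrPdist_le _ _ _ (nbhs x)) => e e0.
have gx : g x = a by rewrite /g eqxx.
have M1_gt0 : 0 < `|M| + 1 by rewrite ltr_wpDl.
near=> z.
have zM : `|f z - f x - a * (z - x)| <= `|M| * `|z - x| ^+ 2.
  have : `|f z - f x - a * (z - x)| <= M * `|z - x| ^+ 2 by near: z.
  move=> zM; have := le_trans (normr_ge0 _) zM => M0.
  by apply: le_trans zM _; rewrite -[leLHS](ger0_norm M0) normrM normrX normr_id.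
rewrite gx /g; case: eqP => [_|/eqP zx]; first by rewrite subrr normr0 ltW.
have zx0 : z - x != 0 by rewrite subr_eq0.
have zx_gt0 : 0 < `|z - x| by rewrite normr_gt0.
rewrite distrC -(ler_pM2r zx_gt0) -normrM mulrBl divfK //.
apply: le_trans zM _; rewrite expr2 mulrA ler_pM2r //.
apply: (@le_trans _ _ ((`|M| + 1) * `|z - x|)).
  by rewrite ler_wpM2r // lerDl.
rewrite mulrC -ler_pdivlMr // distrC ltW //; near: z.
by apply: cvgr_dist_lt; [exact: cvg_id|rewrite divr_gt0].
Unshelve. all: by end_near. Qed.

End Slopes.

(** * Differentiation of power series *)

Section Remainder.
Variable K : numFieldType.
Implicit Types (h k s r : K).

(** A derivative on the disc of radius [s] is controlled on a larger disc, at
    the cost of a factor [1 / (r - s)]. *)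
Lemma pow_slope_le s r n : 0 <= s -> s <= r ->
  n%:R * s ^+ n.-1 * (r - s) <= r ^+ n.
Proof.
move=> s0 sr; have r0 := le_trans s0 sr.
have snrn m : s ^+ m <= r ^+ m by rewrite lerXn2r.
elim: n => [|n IHn]; first by rewrite mul0r mul0r expr0.
have -> : n.+1%:R * s ^+ n = s * (n%:R * s ^+ n.-1) + s ^+ n.
  by case: n {IHn} => [|n]; rewrite /= ?exprS ?expr0 -?natr1; ring.
rewrite mulrDl -mulrA exprS -[X in _ <= X * _](subrKC s r) mulrDl lerD //.
  exact: ler_wpM2l.
by rewrite mulrC ler_wpM2l // subr_ge0.
Qed.

(** The remainders [e_n = (h + k)^n - h^n - n k h^(n-1)] satisfy
    [e_(n+1) = (h + k) e_n + n k^2 h^(n-1)], so that [pow_slope_le] gives the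
    bound by induction, without second derivatives. *)
Lemma pow_taylor2_le h k s r n : 0 <= s -> s <= r -> `|h| <= s -> `|h + k| <= s ->
  `|(h + k) ^+ n - h ^+ n - n%:R * k * h ^+ n.-1| * (r - s) ^+ 2
  <= `|k| ^+ 2 * r ^+ n.
Proof.
move=> s0 sr hs hks; have r0 := le_trans s0 sr.
have rs0 : 0 <= r - s by rewrite subr_ge0.
elim: n => [|n IHn].
  by rewrite !expr0 subrr !mul0r subr0 normr0 mul0r mulr1 exprn_ge0.
have -> : (h + k) ^+ n.+1 - h ^+ n.+1 - n.+1%:R * k * h ^+ n =
    (h + k) * ((h + k) ^+ n - h ^+ n - n%:R * k * h ^+ n.-1)
    + n%:R * h ^+ n.-1 * k ^+ 2.
  case: n {IHn} => [|n]; rewrite /= ?expr0 ?[_ ^+ n.+2]exprS ?[_ ^+ n.+1]exprS -?natr1.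
    by ring.
  by ring.
apply: (@le_trans _ _ (s * (`|k| ^+ 2 * r ^+ n) + (r - s) * (`|k| ^+ 2 * r ^+ n))).
  apply: (@le_trans _ _ ((s * `|(h + k) ^+ n - h ^+ n - n%:R * k * h ^+ n.-1|
      + n%:R * s ^+ n.-1 * `|k| ^+ 2) * (r - s) ^+ 2)).
    rewrite ler_wpM2r ?exprn_ge0 // (le_trans (ler_normD _ _)) // lerD //.
      by rewrite normrM ler_wpM2r.
    rewrite !normrM normr_nat !normrX ler_wpM2r ?exprn_ge0 // ler_wpM2l //.
    by rewrite lerXn2r.
  rewrite mulrDl lerD //; first by rewrite -mulrA ler_wpM2l.
  have -> : n%:R * s ^+ n.-1 * `|k| ^+ 2 * (r - s) ^+ 2 =
    (r - s) * (`|k| ^+ 2 * (n%:R * s ^+ n.-1 * (r - s))) by ring.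
  by rewrite !ler_wpM2l ?exprn_ge0 // pow_slope_le.
by rewrite -mulrDl subrKC [r ^+ n.+1]exprS mulrCA.
Qed.

Lemma geometric_partial_sum_le (t : K) n : 0 <= t -> t < 1 ->
  \sum_(0 <= i < n) t ^+ i <= (1 - t)^-1.
Proof.
move=> t0 t1; have t1' : 0 < 1 - t by rewrite subr_gt0.
rewrite -[leRHS]mul1r ler_pdivlMr // mulrC big_mkord -opprB mulNr -subrX1 opprB.
by rewrite lerBlDr lerDl exprn_ge0.
Qed.

(** Abel's condition; it implies convergence in the open disc of radius [r] and
    is stable under derivation after shrinking [r]. *)
Definition terms_bounded (c : nat -> K) r : Prop :=
  exists M, forall n, `|c n| * r ^+ n <= M.

Lemma terms_bounded_summable (c : nat -> K) r r' :
  0 <= r -> r < r' -> terms_bounded c r' ->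
  exists M, forall N, \sum_(0 <= i < N) `|c i| * r ^+ i <= M.
Proof.
move=> r0 rr' [M cM]; have r'0 : 0 < r' := le_lt_trans r0 rr'.
have M0 : 0 <= M by apply: le_trans (cM 0%N); rewrite expr0 mulr1.
exists (M * (1 - r / r')^-1) => N.
apply: (@le_trans _ _ (\sum_(0 <= i < N) M * (r / r') ^+ i)).
  apply: ler_sum => i _; rewrite expr_div_n mulrA ler_pdivlMr ?exprn_gt0 //.
  by rewrite mulrAC ler_wpM2r ?exprn_ge0.
rewrite -mulr_sumr ler_wpM2l // geometric_partial_sum_le //.
  by rewrite divr_ge0 // ltW.
by rewrite ltr_pdivrMr // mul1r.
Qed.

Lemma terms_bounded_le (c : nat -> K) r r' : 0 <= r -> r <= r' ->
  terms_bounded c r' -> terms_bounded c r.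
Proof.
move=> r0 rr' [M cM]; exists M => n; apply: le_trans (cM n).
by rewrite ler_wpM2l // lerXn2r // nnegrE (le_trans r0).
Qed.

Lemma midpointP r r' : r < r' -> r < (r + r') / 2 /\ (r + r') / 2 < r'.
Proof. by move=> rr'; rewrite (midf_lt rr').1 (midf_lt rr').2. Qed.

End Remainder.

Section PowerSeriesSum.
Variable R : realType.
Local Notation K := (CC R).
Implicit Types (c : nat -> K) (h r : K).

Lemma terms_bounded_deriv c r r' : 0 <= r -> r < r' ->
  terms_bounded c r' -> terms_bounded (ps_deriv c) r.
Proof.
move=> r0 rr' [M cM]; have rr0 : 0 < r' - r by rewrite subr_gt0.
exists (M / (r' - r)) => n; rewrite ler_pdivlMr // normrM normr_nat.
apply: le_trans (cM n.+1).
have -> : n.+1%:R * `|c n.+1| * r ^+ n * (r' - r) =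
    `|c n.+1| * (n.+1%:R * r ^+ n * (r' - r)) by ring.
by rewrite ler_wpM2l //; apply: (@pow_slope_le _ r r' n.+1 r0); exact: ltW.
Qed.

Lemma ps_sum_cvg c h r : `|h| < r -> terms_bounded c r ->
  series (fun n => c n * h ^+ n) @ \oo --> ps_sum c h.
Proof.
move=> hr /(terms_bounded_summable (normr_ge0 h) hr)[M cM].
apply: (@cvg_series_norm_bounded _ _ M) => n; apply: le_trans (cM n).
by apply: ler_sum => i _; rewrite normrM normrX.
Qed.

Lemma cvg_ps_sum c h l :
  series (fun n => c n * h ^+ n) @ \oo --> l -> ps_sum c h = l.
Proof. exact: norm_cvg_lim. Qed.

(** With [|h| < s < t < r] the partial sums of the remainder of order two are
    bounded by [|z - h|^2 * M / (t - s)^2] as long as [|z| < s]; the bound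
    passes to the limit. *)
Lemma is_derive_ps_sum c h r : `|h| < r -> terms_bounded c r ->
  is_derive h 1 (ps_sum c) (ps_sum (ps_deriv c) h).
Proof.
move=> /midpointP[hs sr] cr; set s := (_ / 2) in hs sr.
have [st tr] := midpointP sr; set t := (_ / 2) in st tr.
have s0 : 0 < s := le_lt_trans (normr_ge0 h) hs.
have t0 : 0 < t := lt_trans s0 st.
have ts0 : 0 < t - s by rewrite subr_gt0.
have [M cM] := terms_bounded_summable (ltW t0) tr cr.
have cs : terms_bounded c t := terms_bounded_le (ltW t0) (ltW tr) cr.
have dcs := terms_bounded_deriv (ltW s0) st cs.
apply: (@is_derive_of_quadratic _ _ _ _ (M / (t - s) ^+ 2)).
near=> z.
have zs : `|z| < s.
  by near: z; apply: (@cvgr_norm_lt _ _ _ _ _ idfun h) => //; exact: cvg_id.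
pose S c h := series (fun n => c n * h ^+ n : K).
pose e i := (h + (z - h)) ^+ i - h ^+ i - i%:R * (z - h) * h ^+ i.-1.
have cvgS : (fun N => S c z N.+1 - S c h N.+1 - S (ps_deriv c) h N * (z - h)) @ \oo
    --> ps_sum c z - ps_sum c h - ps_sum (ps_deriv c) h * (z - h).
  apply: cvgB; last first.
    by apply: cvgMl; exact: ps_sum_cvg hs dcs.
  by apply: cvgB; rewrite cvg_shiftS;
    [exact: ps_sum_cvg (lt_trans zs st) cs|exact: ps_sum_cvg (lt_trans hs st) cs].
apply: norm_lim_le cvgS _ => N.
have -> : S c z N.+1 - S c h N.+1 - S (ps_deriv c) h N * (z - h) =
    \sum_(0 <= i < N.+1) c i * e i.
  rewrite /S /series mulr_suml.
  under [RHS]eq_bigr => i _ do rewrite /e subrKC mulrBr mulrBr.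
  rewrite !sumrB; congr (_ - _).
  rewrite [RHS]big_nat_recl //= !mul0r mulr0 add0r.
  by apply: eq_bigr => i _; rewrite /ps_deriv; ring.
rewrite mulrAC ler_pdivlMr ?exprn_gt0 //.
apply: (@le_trans _ _ (\sum_(0 <= i < N.+1) `|c i| * (`|z - h| ^+ 2 * t ^+ i))).
  apply: (@le_trans _ _ ((\sum_(0 <= i < N.+1) `|c i| * `|e i|) * (t - s) ^+ 2)).
    apply: ler_wpM2r; first by rewrite exprn_ge0 // ltW.
    apply: le_trans (ler_norm_sum _ _ _) _.
    by apply: ler_sum => i _; rewrite normrM.
  rewrite mulr_suml; apply: ler_sum => i _; rewrite -mulrA ler_wpM2l //.
  by apply: pow_taylor2_le; rewrite ?subrKC ltW.
under eq_bigr => i _ do rewrite mulrCA.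
by rewrite -mulr_sumr mulrC ler_wpM2r ?exprn_ge0.
Unshelve. all: by end_near. Qed.

Lemma terms_bounded_of_cvg c h (l : K) :
  series (fun n => c n * h ^+ n) @ \oo --> l -> terms_bounded c `|h|.
Proof.
move=> /cvgP/cvg_series_cvg_0 c0.
have /cvg_seq_bounded : cvgn (fun n => c n * h ^+ n) by apply/cvg_ex; exists 0.
move=> [M [_ cM]]; exists (M + 1) => n; rewrite -normrX -normrM.
by apply: cM; rewrite ?ltrDl.
Qed.

End PowerSeriesSum.

(** * The exponential function and determinations of the logarithm *)

Section Exponential.
Variable R : realType.
Local Notation K := (CC R).
Local Notation rc := (real_complex R).

(** Evaluated at [1] this is the [n]-th partial sum of [exp x]; keeping the terms
    as coefficients makes the Cauchy product a product of polynomials. *)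
Definition exp_poly (F : numFieldType) n (x : F) : {poly F} :=
  \poly_(i < n) (x ^+ i / i`!%:R).

Lemma horner1_exp_poly (F : numFieldType) n (x : F) :
  (exp_poly n x).[1] = \sum_(0 <= i < n) x ^+ i / i`!%:R.
Proof.
rewrite (@horner_coef_wide _ n) ?size_poly // big_mkord.
by apply: eq_bigr => i _; rewrite expr1n mulr1 coef_poly ltn_ord.
Qed.

(** The coefficients of index [m < n] of the product are [(x + y)^m / m!]; only
    those of index at least [n] remain. *)
Lemma exp_polyD (F : numFieldType) n (x y : F) :
  (exp_poly n x).[1] * (exp_poly n y).[1] - (exp_poly n (x + y)).[1]
  = \sum_(n <= m < n + n) (exp_poly n x * exp_poly n y)`_m.
Proof.
have sz : (size (exp_poly n x * exp_poly n y)%R <= n + n)%N.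
  apply: leq_trans (size_polyMleq _ _) _; apply: leq_trans (leq_pred _) _.
  by rewrite leq_add ?size_poly.
rewrite -hornerM (horner_coef_wide _ sz) horner1_exp_poly.
under eq_bigr => i _ do rewrite expr1n mulr1.
rewrite -(big_mkord xpredT (fun i => (exp_poly n x * exp_poly n y)`_i)).
rewrite (@big_cat_nat _ _ _ n) ?leq_addr //=.
rewrite (_ : \sum_(0 <= i < n) (x + y) ^+ i / i`!%:R =
  \sum_(0 <= i < n) (exp_poly n x * exp_poly n y)`_i).
  by rewrite addrAC subrr add0r.
apply: eq_big_nat => m /andP[_ mn].
rewrite coefMr exprDn mulr_suml; apply: eq_bigr => i _.
have im : (i <= m)%N by rewrite -ltnS.
rewrite !coef_poly (leq_ltn_trans im mn) (leq_ltn_trans (leq_subr _ _) mn).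
have fact0 k : k`!%:R != 0 :> F by rewrite pnatr_eq0 -lt0n fact_gt0.
rewrite -(bin_fact im) !natrM -mulr_natr; field.
by rewrite !fact0 pnatr_eq0 -lt0n bin_gt0 im.
Qed.

(** The defect of multiplicativity has nonnegative coefficients, so it is
    dominated by the one at [|x|], [|y|]. *)
Lemma norm_exp_polyD (F : numFieldType) (x y : F) n :
  `|(exp_poly n x).[1] * (exp_poly n y).[1] - (exp_poly n (x + y)).[1]|
  <= (exp_poly n `|x|).[1] * (exp_poly n `|y|).[1] - (exp_poly n (`|x| + `|y|)).[1].
Proof.
rewrite !exp_polyD; apply: le_trans (ler_norm_sum _ _ _) _; apply: ler_sum => m _.
rewrite !coefM; apply: le_trans (ler_norm_sum _ _ _) _; apply: ler_sum => i _.
rewrite !coef_poly normrM.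
by do 2!case: ifP => _; rewrite ?normr0 // !normrM !normrX !normfV !normr_nat.
Qed.

Lemma exp_poly_real n (x : K) (a : R) : x = rc a ->
  (exp_poly n x).[1] = rc (series (exp_coeff a) n).
Proof.
move=> ->; rewrite horner1_exp_poly [RHS]rmorph_sum; apply: eq_bigr => i _.
by rewrite /exp_coeff /= rmorphM fmorphV rmorph_nat rmorphXn.
Qed.

Lemma exp_poly_defect_real n (x y : K) (a b : R) : x = rc a -> y = rc b ->
  (exp_poly n x).[1] * (exp_poly n y).[1] - (exp_poly n (x + y)).[1] =
  rc (series (exp_coeff a) n * series (exp_coeff b) n - series (exp_coeff (a + b)) n).
Proof.
move=> xa yb; have xyab : x + y = rc (a + b) by rewrite xa yb rmorphD.
rewrite (exp_poly_real n xa) (exp_poly_real n yb) (exp_poly_real n xyab).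
by rewrite [RHS]rmorphB [in RHS]rmorphM.
Qed.

Lemma terms_bounded_fact (r : K) : 0 <= r ->
  terms_bounded (fun n => (n`!%:R)^-1) r.
Proof.
move=> /real_complex_ge0[a a0 ->].
have [M [_ aM]] := cvg_series_bounded (is_cvg_series_exp_coeff a).
exists (rc (M + 1)) => n.
have aMn : `|exp_coeff a n| <= M + 1 by apply: aM; rewrite ?ltrDl.
apply: (@le_trans _ _ (rc `|exp_coeff a n|)); last by rewrite lecR.
rewrite (_ : exp_coeff a n = a ^+ n / n`!%:R) //.
rewrite [in leRHS]ger0_norm ?divr_ge0 ?exprn_ge0 //.
by rewrite [leRHS]rmorphM fmorphV rmorph_nat rmorphXn mulrC normfV normr_nat.
Qed.

Lemma ps_deriv_fact : ps_deriv (fun n => (n`!%:R)^-1 : K) = (fun n => (n`!%:R)^-1).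
Proof.
apply/funext => n; rewrite /ps_deriv factS natrM invfM mulrA divff ?mul1r // pnatr_eq0.
Qed.

Lemma is_derive_cexp (w : K) : is_derive w 1 (@cexp K) (cexp w).
Proof.
rewrite -[X in is_derive _ _ _ X]/(ps_sum _ w) -ps_deriv_fact.
apply: (@is_derive_ps_sum _ _ _ (`|w| + 1)); first by rewrite ltrDl.
by apply: terms_bounded_fact; rewrite addr_ge0.
Qed.

Lemma cexp_cvg (w : K) : (fun n => (exp_poly n w).[1]) @ \oo --> cexp w.
Proof.
have w1 : `|w| < `|w| + 1 by rewrite ltrDl.
have := ps_sum_cvg w1 (terms_bounded_fact (le_trans (normr_ge0 w) (ltW w1))).
rewrite (_ : series _ = fun n => (exp_poly n w).[1]) //.
by apply/funext => n; rewrite horner1_exp_poly; apply: eq_bigr => i _; rewrite mulrC.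
Qed.

(** The defect at the real numbers [|x|], [|y|] tends to [0] by the functional
    equation of the real exponential. *)
Lemma cexpD (x y : K) : cexp (x + y) = cexp x * cexp y.
Proof.
apply/esym/eqP; rewrite -subr_eq0; apply/eqP.
pose u n := (exp_poly n x).[1] * (exp_poly n y).[1] - (exp_poly n (x + y)).[1].
have ul : u @ \oo --> cexp x * cexp y - cexp (x + y).
  by apply: cvgB; [apply: cvgM|]; exact: cexp_cvg.
have [a a0 xa] := real_complex_ge0 (normr_ge0 x).
have [b b0 yb] := real_complex_ge0 (normr_ge0 y).
pose v n : R := series (exp_coeff a) n * series (exp_coeff b) n
  - series (exp_coeff (a + b)) n.
have v0 : v @ \oo --> 0.
  rewrite -(subrr (expR (a + b))) [X in _ --> X - _]expRD.
  by apply: cvgB; [apply: cvgM|]; exact: is_cvg_series_exp_coeff.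
suff u0 : u @ \oo --> 0 by rewrite -(norm_cvg_lim ul); exact: norm_cvg_lim.
apply/cvgr0Pnorm_le => e e0; have [r _ er] := real_complex_ge0 (ltW e0).
have r0 : 0 < r by rewrite -ltcR -er.
near=> n; apply: le_trans (norm_exp_polyD x y n) _.
have -> := exp_poly_defect_real n xa yb.
rewrite er lecR.
apply: le_trans (ler_norm _) _; near: n.
by move/cvgr0Pnorm_le: v0; exact.
Unshelve. all: by end_near. Qed.

Lemma ps_sum0 (c : nat -> K) : ps_sum c 0 = c 0%N.
Proof.
apply: cvg_ps_sum; rewrite -cvg_shiftS.
rewrite (_ : (fun n => _) = cst (c 0%N)); first exact: cvg_cst.
apply/funext => n; rewrite /series /= big_nat_recl // expr0 mulr1 big1 ?addr0 //.
by move=> i _; rewrite expr0n mulr0.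
Qed.

Lemma cexp0 : cexp 0 = 1 :> K.
Proof. by rewrite /cexp ps_sum0 fact0 invr1. Qed.

Lemma cexp_neq0 (w : K) : cexp w != 0.
Proof.
apply/negP => /eqP w0; have := cexpD w (- w); rewrite subrr cexp0 w0 mul0r.
by move/eqP; rewrite oner_eq0.
Qed.

Lemma cexpN (w : K) : cexp (- w) = (cexp w)^-1.
Proof.
by apply: (mulfI (cexp_neq0 w)); rewrite -cexpD subrr cexp0 divff ?cexp_neq0.
Qed.

Lemma cexp_nat n (w : K) : cexp (n%:R * w) = cexp w ^+ n.
Proof.
elim: n => [|n IHn]; first by rewrite mul0r cexp0 expr0.
by rewrite -natr1 mulrDl mul1r cexpD IHn exprSr.
Qed.

Lemma algebraicX n (x : K) : algebraic_number x -> algebraic_number (x ^+ n).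
Proof.
move=> alg_x; elim: n => [|n IHn]; first exact: (algebraic_nat _ 1).
by rewrite exprS; exact: algebraic_mul.
Qed.

Lemma algebraic_root n (x : K) : (0 < n)%N ->
  algebraic_number (x ^+ n) -> algebraic_number x.
Proof.
move=> n0 [p p0 px]; exists (p \Po 'X^n).
  by rewrite comp_poly_eq0 ?size_polyXn.
by rewrite map_comp_poly map_polyXn /root horner_comp hornerXn.
Qed.

(** If [z = exp w] and [s = p / q], then [(z^s)^q = z^p]. *)
Lemma algebraic_cexp (s : rat) (w : K) : algebraic_number (cexp w) ->
  algebraic_number (cexp (ratr s * w)).
Proof.
move=> alg_w; have [d dE] : exists d, denq s = Posz d.+1.
  by case: (denq s) (denq_gt0 s) => [[|d]|d] // _; exists d.
apply: (@algebraic_root d.+1) => //; rewrite -cexp_nat mulrA.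
have -> : d.+1%:R * ratr s = (numq s)%:~R :> K.
  rewrite -[s in LHS]divq_num_den dE rmorphM fmorphV /= !ratr_int.
  by rewrite mulrCA mulfV ?mulr1 // pnatr_eq0.
case: (numq s) => n; first by rewrite [_%:~R]/(n%:R) cexp_nat; exact: algebraicX.
rewrite NegzE mulrNz mulNr cexpN [_%:~R]/(n.+1%:R) cexp_nat.
by apply: algebraic_inv; exact: algebraicX.
Qed.

Lemma is_derive_log (a : K) (l : K -> K) : log_determination a l ->
  \forall z \near a, is_derive (z : K) (1 : K) l (cexp (- l z)).
Proof.
move=> al.
have al2 : \forall z \near a, \forall y \near z, {for y, continuous l} /\ cexp (l y) = y.
  exact: near_join al.
near=> z.
have zl : \forall y \near z, {for y, continuous l} /\ cexp (l y) = y.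
  by near: z.
rewrite cexpN; apply: (is_derive_right_inverse (f := @cexp K)).
- exact: cexp_neq0.
- by near=> y; have [] : {for y, continuous l} /\ cexp (l y) = y by near: y.
- by have [] := nbhs_singleton zl.
- exact: is_derive_cexp.
Unshelve. all: by end_near. Qed.

End Exponential.

(** * Connexion constants *)
Section LeftInverse.
Variable C : numClosedFieldType.

(** The ranks of the truncated matrices [(g i n)_(n < N)] are bounded by [m].
    Where the rank is maximal the left kernel no longer shrinks, so that it
    consists of relations between the whole sequences [g i] and is zero. *)
Lemma algebraic_left_inverse m (g : 'I_m -> nat -> C) :
    (forall i n, algebraic_number (g i n)) ->
    (forall d : 'I_m -> C, (forall n, \sum_i d i * g i n = 0) -> forall i, d i = 0) ->
  exists N (u : 'I_m -> nat -> C), (forall k n, algebraic_number (u k n)) /\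
    forall i k, \sum_(n < N) u k n * g i n = (i == k)%:R.
Proof.
move=> alg_g free_g.
have [g0 g0E] := algnum_lift (f := fun i : 'I_m * nat => g i.1 i.2)
  (fun i => alg_g i.1 i.2).
pose A N : 'M[algnum C]_(m, N) := \matrix_(i, n) g0 (i, val n).
pose P r := `[< exists N, \rank (A N) = r >].
have exP : exists r, P r by exists (\rank (A 0)); apply/asboolP; exists 0%N.
have boundP r : P r -> (r <= m)%N by move=> /asboolP[N <-]; exact: rank_leq_row.
case: (ex_maxnP exP boundP) => r /asboolP[N rankN] max_r.
have freeN : row_free (A N).
  rewrite -kermx_eq0; apply/rowV0P => d /sub_kermxP dN.
  have dA n : (\sum_i d 0 i * g0 (i, n)) = 0.
    pose B := A (N + n.+1)%N.
    have kerS : (kermx B <= kermx (A N))%MS.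
      apply/sub_kermxP/matrixP => i j; rewrite [RHS]mxE.
      have /matrixP/(_ i (lshift n.+1 j)) := mulmx_ker B.
      rewrite [RHS]mxE => B0; rewrite -[RHS]B0 !mxE; apply: eq_bigr => l _.
      by rewrite [A N _ _]mxE [B _ _]mxE.
    have dB : (d <= kermx B)%MS.
      have rankB : \rank (kermx B) = \rank (kermx (A N)).
        apply/eqP; rewrite eqn_leq; apply/andP; split; first exact: mxrankS.
        rewrite !mxrank_ker; apply: leq_sub2l; rewrite rankN; apply: max_r.
        by apply/asboolP; exists (N + n.+1)%N.
      have := (mxrank_leqif_sup kerS).2; rewrite rankB eqxx => /esym.
      by apply: submx_trans; apply/sub_kermxP.
    have nB : (n < N + n.+1)%N by rewrite addnS ltnS leq_addl.
    have /sub_kermxP/matrixP/(_ 0 (Ordinal nB)) := dB.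
    rewrite [RHS]mxE => dB0; rewrite -[RHS]dB0 [RHS]mxE.
    by apply: eq_bigr => i _; rewrite [B _ _]mxE.
  apply/rowP => i; rewrite mxE; apply: algnum_val_inj; rewrite rmorph0.
  apply: (free_g (fun i => algnum_val (d 0 i))) => n.
  have := congr1 (@algnum_val C) (dA n); rewrite rmorph0 => d0; rewrite -[RHS]d0.
  by rewrite rmorph_sum; apply: eq_bigr => l _; rewrite -[g l n](g0E (l, n)) rmorphM.
exists N, (fun k n => if insub n is Some j then algnum_val (pinvmx (A N) j k) else 0).
split=> [k n|i k].
  case: insub => [j|]; [exact: algebraic_algnum|exact: (algebraic_nat _ 0)].
have /matrixP/(_ i k) := mulmxVp freeN.
move=> /(congr1 (@algnum_val C)); rewrite !mxE rmorph_sum rmorph_nat => <-.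
apply: eq_bigr => n _.
by rewrite valK [A N i n]mxE rmorphM -[g i n](g0E (i, val n)) mulrC.
Qed.

End LeftInverse.

Section Values.
Variable R : realType.
Local Notation K := (CC R).
Implicit Types (f g : nat -> K) (z alpha v : K).

Lemma E_function_terms_bounded f r : E_function f -> 0 <= r -> terms_bounded f r.
Proof.
move=> [a [c [[fE alg_a] c0 conj_a _ _]]] r0; have c_ge0 := ltW c0.
have [M cM] := terms_bounded_fact (mulr_ge0 c_ge0 r0).
exists (c * M) => n; rewrite fE normrM -mulrA.
have an : `|a n| <= c ^+ n.+1.
  have [p p_irr pa] := irreducible_annihilator (alg_a n).
  by apply: conj_a; exists p; rewrite ?pa.
apply: le_trans (ler_wpM2r _ an) _; first by rewrite mulr_ge0 ?exprn_ge0.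
rewrite exprS -mulrA ler_wpM2l //; apply: le_trans (cM n).
by rewrite exprMn mulrCA.
Qed.

Lemma E_function_cvg f z : E_function f ->
  series (fun n => f n * z ^+ n) @ \oo --> ps_sum f z.
Proof.
move=> Ef; apply: (@ps_sum_cvg _ _ _ (`|z| + 1)); first by rewrite ltrDl.
by apply: E_function_terms_bounded => //; rewrite addr_ge0.
Qed.

Lemma is_derive_E_function f z : E_function f ->
  is_derive z 1 (ps_sum f) (ps_sum (ps_deriv f) z).
Proof.
move=> Ef; apply: (@is_derive_ps_sum _ _ _ (`|z| + 1)); first by rewrite ltrDl.
by apply: E_function_terms_bounded => //; rewrite addr_ge0.
Qed.

(** Fixing the point makes stability under addition that of E-functions. *)
Definition E_value_at alpha v : Prop := exists2 f, E_function f & v = ps_sum f alpha.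

Lemma E_value_at0 alpha : E_value_at alpha 0.
Proof.
exists (fun=> 0); first exact: E_function0.
rewrite (cvg_ps_sum (l := 0)) //.
rewrite (_ : series _ = cst 0); first exact: cvg_cst.
by apply/funext => n; rewrite /series /= big1 // => i _; rewrite mul0r.
Qed.

Lemma E_value_atD alpha v w :
  E_value_at alpha v -> E_value_at alpha w -> E_value_at alpha (v + w).
Proof.
move=> [f Ef ->] [g Eg ->]; exists (fun n => f n + g n); first exact: E_functionD.
apply/esym/cvg_ps_sum.
rewrite (_ : series _ =
    series (fun n => f n * alpha ^+ n) + series (fun n => g n * alpha ^+ n)).
  by apply: cvgD; exact: E_function_cvg.
apply/funext => n; rewrite /series /= -[RHS]big_split /=.
by apply: eq_bigr => i _; rewrite mulrDl.
Qed.

Lemma E_value_atZ alpha a v : algebraic_number a ->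
  E_value_at alpha v -> E_value_at alpha (a * v).
Proof.
move=> alg_a [f Ef ->]; exists (fun n => a * f n); first exact: E_functionZ.
apply/esym/cvg_ps_sum.
rewrite (_ : series _ = fun n => a * series (fun n => f n * alpha ^+ n) n).
  by apply: cvgMr; exact: E_function_cvg.
by apply/funext => n; rewrite /series /= mulr_sumr; apply: eq_bigr => i _; rewrite mulrA.
Qed.

Definition algebraic_submodule (X : K -> Prop) : Prop :=
  [/\ X 0, forall v w, X v -> X w -> X (v + w)
    & forall a v, algebraic_number a -> X v -> X (a * v)].

Definition closed_under_derivation alpha (V : (K -> K) -> Prop) : Prop :=
  forall h, V h -> exists2 h', V h' &
    \forall z \near alpha, is_derive (z : K) (1 : K) h (h' z).

(** Both [n! * c n] and [h'] are obtained by deriving [n] times, on the series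
    and inside [V] respectively. *)
Lemma taylor_coefficient_value alpha (V : (K -> K) -> Prop) c r h n :
    closed_under_derivation alpha V -> 0 < r -> terms_bounded c r -> V h ->
    (\forall z \near alpha, h z = ps_sum c (z - alpha)) ->
  exists2 h', V h' & n`!%:R * c n = h' alpha.
Proof.
move=> V_deriv; elim: n c r h => [|n IHn] c r h r0 cr Vh hE.
  by exists h => //; rewrite (nbhs_singleton hE) subrr ps_sum0 mul1r.
have [h' Vh' dh] := V_deriv _ Vh.
have [r2_gt0 r2r] := midpointP r0.
have dcr := terms_bounded_deriv (ltW r2_gt0) r2r cr.
have [h2 Vh2 h2E] : exists2 h2, V h2 & n`!%:R * ps_deriv c n = h2 alpha.
  apply: (IHn (ps_deriv c) ((0 + r) / 2) h' r2_gt0 dcr Vh').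
  have hE2 : \forall z \near alpha, \forall y \near z, h y = ps_sum c (y - alpha).
    exact: near_join hE.
  near=> z.
  have zr : `|z - alpha| < r.
    rewrite distrC; near: z; apply: cvgr_dist_lt => //; exact: cvg_id.
  have d1 : is_derive z 1 h (ps_sum (ps_deriv c) (z - alpha)).
    apply: (near_eq_is_derive (f := ps_sum c \o (fun z => z - alpha))).
      have : \forall y \near z, h y = ps_sum c (y - alpha) by near: z.
      by apply: filterS => y ->.
    rewrite -[X in is_derive _ _ _ X]mulr1; apply: is_derive_comp.
      exact: is_derive_ps_sum zr cr.
    have := is_deriveB (is_derive_id z (1 : K)) (is_derive_cst alpha z (1 : K)).
    by rewrite subr0.
  have d2 : is_derive z 1 h (h' z) by near: z.
  by rewrite -(@derive_val _ _ _ _ _ _ _ d2) (@derive_val _ _ _ _ _ _ _ d1).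
exists h2 => //; rewrite -h2E /ps_deriv factS natrM; ring.
Unshelve. all: by end_near. Qed.

End Values.

Section Connexion.
Variable R : realType.
Local Notation K := (CC R).

Lemma terms_bounded_near (c : nat -> K) (alpha : K) (S : K -> K) :
    (\forall z \near alpha, series (fun n => c n * (z - alpha) ^+ n) @ \oo --> S z) ->
  exists2 r : K, 0 < r & terms_bounded c r.
Proof.
move=> /(@nbhs_ballP K K)[e /= e0 eS].
have e2 : 0 < e / 2 by rewrite divr_gt0.
exists (e / 2) => //; rewrite -(gtr0_norm e2).
have /eS : ball alpha e (alpha + e / 2).
  rewrite -ball_normE /ball_ /= opprD addNKr normrN gtr0_norm // ltr_pdivrMr //.
  by rewrite mulr_natr mulr2n ltrDl.
by rewrite /= addrAC subrr add0r; exact: terms_bounded_of_cvg.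
Qed.

(** The abstract form of the argument: [V] is a class of functions stable under
    [d/dz] whose values at [alpha] lie in [X]. *)
Lemma connexion_constants_in m (g : 'I_m -> nat -> K) (G : 'I_m -> K -> K)
    (omega : 'I_m -> K) alpha (V : (K -> K) -> Prop) (X : K -> Prop) h :
    algebraic_submodule X -> closed_under_derivation alpha V ->
    (forall h, V h -> X (h alpha)) -> V h ->
    (forall i n, algebraic_number (g i n)) ->
    (forall i, \forall z \near alpha,
       series (fun n => g i n * (z - alpha) ^+ n) @ \oo --> G i z) ->
    (forall c : 'I_m -> K, (\forall z \near alpha, \sum_i c i * G i z = 0) ->
       forall i, c i = 0) ->
    (\forall z \near alpha, h z = \sum_i omega i * G i z) ->
  forall i, X (omega i).
Proof.
move=> [X0 XD XZ] V_deriv VX Vh alg_g gG free_G hG k.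
have gG_all : \forall z \near alpha, forall i,
    series (fun n => g i n * (z - alpha) ^+ n) @ \oo --> G i z.
  exact: (@filter_forall _ _ _ (nbhs alpha) _ gG).
have combG (d : 'I_m -> K) : \forall z \near alpha,
    series (fun n => (\sum_i d i * g i n) * (z - alpha) ^+ n) @ \oo
    --> \sum_i d i * G i z.
  move: gG_all; apply: filterS => z gGz.
  rewrite (_ : series _ = fun n =>
      \sum_i d i * series (fun n => g i n * (z - alpha) ^+ n) n).
    by apply: cvg_big => // [|i _]; [exact: add_continuous|apply: cvgMr; exact: gGz].
  apply/funext => n; rewrite /series /=.
  under eq_bigr => j _ do rewrite mulr_suml.
  rewrite exchange_big /=; apply: eq_bigr => i _.
  by rewrite mulr_sumr; apply: eq_bigr => j _; rewrite mulrA.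
have [|N [u [alg_u uE]]] := algebraic_left_inverse alg_g.
  move=> d d0; apply: free_G; move: (combG d); apply: filterS => z.
  rewrite (_ : series _ = cst 0); last first.
    by apply/funext => n; rewrite /series /= big1 // => j _; rewrite d0 mul0r.
  by move=> dG; rewrite -(norm_cvg_lim dG); apply: norm_cvg_lim; exact: cvg_cst.
pose c n := \sum_i omega i * g i n.
have [r r0 cr] := terms_bounded_near (combG omega).
have hc : \forall z \near alpha, h z = ps_sum c (z - alpha).
  near=> z; have -> : h z = \sum_i omega i * G i z by near: z.
  by apply/esym/cvg_ps_sum; near: z; exact: combG.
have Xc n : X (n`!%:R * c n).
  have [h' Vh' ->] := taylor_coefficient_value n V_deriv r0 cr Vh hc.
  exact: VX.
have -> : omega k = \sum_(n < N) (u k n / n`!%:R) * (n`!%:R * c n).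
  transitivity (\sum_(n < N) u k n * c n).
    under eq_bigr => n _ do rewrite mulr_sumr.
    rewrite exchange_big /= (bigD1 k) //= [X in _ + X]big1 => [|i ik].
      rewrite addr0; under eq_bigr => n _ do rewrite mulrCA.
      by rewrite -mulr_sumr uE eqxx mulr1.
    under eq_bigr => n _ do rewrite mulrCA.
    by rewrite -mulr_sumr uE (negPf ik) mulr0.
  by apply: eq_bigr => n _; rewrite mulrA divfK // pnatr_eq0 -lt0n fact_gt0.
elim/big_ind: _ => // n _; apply: XZ => //.
exact: algebraic_div (alg_u k n) (algebraic_nat _ _).
Unshelve. all: by end_near. Qed.

Variables (alpha : K) (ell : K -> K).

(** Combinations of the functions [z^s * log(z)^k * f z], with [z^s] defined by
    the determination [ell] of the logarithm. *)
Inductive log_combination : (K -> K) -> Prop :=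
| log_term a (s : rat) k f of algebraic_number a & E_function f :
    log_combination (fun z => a * cexp (ratr s * ell z) * ell z ^+ k * ps_sum f z)
| log_zero : log_combination (fun=> 0)
| log_add h1 h2 of log_combination h1 & log_combination h2 :
    log_combination (fun z => h1 z + h2 z).

Lemma log_combination_sum (I : eqType) (r : seq I) (h : I -> K -> K) :
  (forall i, i \in r -> log_combination (h i)) ->
  log_combination (fun z => \sum_(i <- r) h i z).
Proof.
elim: r => [|i r IHr] hr.
  by under eq_fun do rewrite big_nil; exact: log_zero.
under eq_fun do rewrite big_cons; apply: log_add; first by apply: hr; rewrite mem_head.
by apply: IHr => j jr; apply: hr; rewrite inE jr orbT.
Qed.

Lemma log_combination_deriv : log_determination alpha ell ->
  closed_under_derivation alpha log_combination.
Proof.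
move=> /is_derive_log dell h.
elim=> {h} [a s k f alg_a Ef| |h1 h2 _ [h1' V1 d1] _ [h2' V2 d2]].
- exists (fun z =>
      a * ratr s * cexp (ratr (s - 1) * ell z) * ell z ^+ k * ps_sum f z
      + a * k%:R * cexp (ratr (s - 1) * ell z) * ell z ^+ k.-1 * ps_sum f z
      + a * cexp (ratr s * ell z) * ell z ^+ k * ps_sum (ps_deriv f) z).
    apply: log_add; first apply: log_add; apply: log_term => //.
    + exact: algebraic_mul alg_a (algebraic_rat _ _).
    + exact: algebraic_mul alg_a (algebraic_nat _ _).
    + exact: E_function_deriv.
  (* [ell' z = 1 / z] lowers the exponent [s] by one: [z^s / z = z^(s - 1)]. *)
  near=> z; have dz : is_derive z 1 ell (cexp (- ell z)) by near: z.
  have dsz : is_derive z 1 (fun z => ratr s * ell z) (ratr s * cexp (- ell z)).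
    have := is_deriveM (is_derive_cst (ratr s : K) z (1 : K)) dz.
    by rewrite scaler0 addr0.
  have d1 := is_derive_comp (g := fun z => ratr s * ell z)
    (is_derive_cexp (ratr s * ell z)) dsz.
  have d2 := is_deriveX k dz.
  have d3 := is_derive_E_function z Ef.
  have := is_deriveM (is_deriveM (is_deriveM (is_derive_cst a z (1 : K)) d1) d2) d3.
  rewrite exprfctE => d4; apply: is_derive_eq d4 _ => /=.
  rewrite rmorphB rmorph1 mulrBl mul1r cexpD.
  rewrite !mulrfctE /GRing.scale /=.
  move: (cexp (- ell z)) (cexp (ratr s * ell z)) (ell z ^+ k) (ell z ^+ k.-1)
    (ps_sum f z) (ps_sum (ps_deriv f) z).
  by move=> x1 x2 x3 x4 x5 x6; ring.
- exists (fun=> 0); first exact: log_zero.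
  by near=> z; exact: is_derive_cst.
- exists (fun z => h1' z + h2' z); first exact: log_add.
  near=> z; have dh1 : is_derive z 1 h1 (h1' z) by near: z.
  have dh2 : is_derive z 1 h2 (h2' z) by near: z.
  exact: is_deriveD.
Unshelve. all: by end_near. Qed.

(** The ring [E[l]] restricted to coefficients that are values at [alpha], for
    which stability under addition is immediate. *)
Definition E_value_at_adjoin (l v : K) : Prop :=
  exists2 p : {poly K}, (forall i, E_value_at alpha p`_i) & v = p.[l].

Lemma E_value_at_adjoin_submodule l : algebraic_submodule (E_value_at_adjoin l).
Proof.
split=> [|_ _ [p pE ->] [q qE ->]|a _ alg_a [p pE ->]].
- by exists 0; [move=> i; rewrite coef0; exact: E_value_at0|rewrite horner0].
- exists (p + q); last by rewrite hornerD.
  by move=> i; rewrite coefD; exact: E_value_atD.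
- exists (a *: p); last by rewrite hornerZ.
  by move=> i; rewrite coefZ; exact: E_value_atZ.
Qed.

Lemma E_value_at_submodule : algebraic_submodule (E_value_at alpha).
Proof.
split; [exact: E_value_at0|move=> v w; exact: E_value_atD|move=> a v; exact: E_value_atZ].
Qed.

Lemma log_combination_value h : algebraic_number (cexp (ell alpha)) ->
  log_combination h -> E_value_at_adjoin (ell alpha) (h alpha).
Proof.
move=> alg_alpha; have [X0 XD _] := E_value_at_adjoin_submodule (ell alpha).
elim=> {h} [a s k f alg_a Ef||h1 h2 _ IH1 _ IH2]; [|exact: X0|exact: XD].
pose b := a * cexp (ratr s * ell alpha).
have alg_b : algebraic_number b.
  exact: algebraic_mul alg_a (algebraic_cexp s alg_alpha).
exists ((b * ps_sum f alpha) *: 'X^k); last by rewrite hornerZ hornerXn /b; ring.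
move=> i; rewrite coefZ coefXn; case: (i == k); rewrite ?mulr0 ?mulr1.
  by apply: E_value_atZ => //; exists f.
exact: E_value_at0.
Qed.

End Connexion.

Theorem theorem2 (R : realType) (mu : nat) (L : diffop (CC R))
    (E : 'I_mu -> nat -> CC R) (M : 'M[rat]_mu)
    (S : 'I_mu -> {fset rat}) (K : 'I_mu -> {fset nat})
    (phi : 'I_mu -> rat -> nat -> CC R) (F : CC R -> CC R)
    (alpha : CC R) (ell : CC R -> CC R)
    (g : 'I_mu -> nat -> CC R) (G : 'I_mu -> CC R -> CC R)
    (omega : 'I_mu -> CC R) :
  E_operator L -> diffop_order L = mu ->
  (forall j, E_function (E j)) ->
  (forall i j : 'I_mu, (j < i)%N -> M i j = 0) ->
  germ_basis (@log_nbhs0 (CC R)) (solution_at0 L) (E_times_zM E M) ->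
  solution_at0 L F ->
  (forall w, F w = \sum_(j < mu)
     (\sum_(s <- S j) \sum_(k <- K j)
        phi j s k * cexp (ratr s * w) * w ^+ k) * ps_sum (E j) (cexp w)) ->
  algebraic_number alpha -> alpha != 0 ->
  log_determination alpha ell ->
  (forall i n, algebraic_number (g i n)) ->
  (forall i, \forall z \near alpha,
     series (fun n => g i n * (z - alpha) ^+ n) @ \oo --> G i z) ->
  germ_basis (nbhs alpha) (holomorphic_solution L alpha) G ->
  (\forall z \near alpha, F (ell z) = \sum_(i < mu) omega i * G i z) ->
  (forall j s k, s \in S j -> k \in K j -> algebraic_number (phi j s k)) ->
  (forall i, E_value_adjoin (ell alpha) (omega i)) /\
  ((exists2 f, E_function f & forall w, F w = ps_sum f (cexp w)) ->
   forall i, E_value (omega i)).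
Proof.
move=> _ _ EE _ _ _ FE alg_alpha _ log_ell alg_g gG [_ free_G _] FG alg_phi.
have cexp_ell : \forall z \near alpha, cexp (ell z) = z.
  by move: log_ell; apply: filterS => z [].
have E_value_of v : E_value_at alpha v -> E_value v.
  by move=> [f Ef ->]; exists f, alpha.
split=> [i|[f Ef Ff] i].
- pose h z := \sum_(j < mu) \sum_(s <- S j) \sum_(k <- K j)
    phi j s k * cexp (ratr s * ell z) * ell z ^+ k * ps_sum (E j) z.
  have Vh : log_combination ell h.
    apply: log_combination_sum => j _; apply: log_combination_sum => s sS.
    apply: log_combination_sum => k kK; apply: log_term; last exact: EE.
    exact: alg_phi.
  have hG : \forall z \near alpha, h z = \sum_(i < mu) omega i * G i z.
    near=> z; have <- : F (ell z) = \sum_(i < mu) omega i * G i z by near: z.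
    rewrite FE; have -> : cexp (ell z) = z by near: z.
    apply: eq_bigr => j _; rewrite mulr_suml; apply: eq_bigr => s _.
    by rewrite mulr_suml.
  have [|p pE ->] := connexion_constants_in
    (E_value_at_adjoin_submodule alpha (ell alpha)) (log_combination_deriv log_ell) _ Vh
    alg_g gG free_G hG i.
    by move=> h1; apply: log_combination_value; rewrite (nbhs_singleton cexp_ell).
  by exists p => // j; apply: E_value_of; exact: pE.
- pose V h := exists2 f1, E_function f1 & h = @ps_sum (CC R) f1.
  apply: E_value_of; apply: (connexion_constants_in (V := V) (h := @ps_sum (CC R) f)
    (E_value_at_submodule alpha) _ _ _ alg_g gG free_G).
  + move=> _ [f1 Ef1 ->]; exists (ps_sum (ps_deriv f1)).
      by exists (ps_deriv f1) => //; exact: E_function_deriv.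
    by near=> z; exact: is_derive_E_function.
  + by move=> _ [f1 Ef1 ->]; exists f1.
  + by exists f.
  + near=> z; have <- : F (ell z) = \sum_(i < mu) omega i * G i z by near: z.
    by rewrite Ff; congr ps_sum; apply/esym; near: z.
Unshelve. all: by end_near. Qed.
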